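(* Let $q$ be a prime power and let $n,k,t$ be integers with $k>t\ge 1$ and $n\ge 2k$. Define $\epsilon(q)$ by $\epsilon(2)=9$, $\epsilon(3)=3$, $\epsilon(4)=2$, $\epsilon(q)=1$ for $5\le q\le 8$, and $\epsilon(q)=0$ for $q\ge 9$. Suppose that one of the following conditions holds: (1) $t\le \epsilon(q)$ and $n>3k-2t+\epsilon(q)$; (2) $t>\epsilon(q)$ and $n>3k-t+1-2\sqrt{t-\epsilon(q)}$. Then the treewidth of the $q$-Kneser graph $K_q(n,k,t)$ satisfies $$\operatorname{tw}(K_q(n,k,t))=\begin{bmatrix} n\\ k\end{bmatrix}_q-\begin{bmatrix} n-t\\ k-t\end{bmatrix}_q-1.$$
   Context: For a prime power $q$ and integers $k>t\ge 1$, $n>2k-t$, the $q$-Kneser graph $K_q(n,k,t)$ is the graph whose vertices are the $k$-dimensional subspaces of $F_q^n$, two vertices $U_1,U_2$ being adjacent iff $\dim(U_1\cap U_2)<t$. For integers $n\ge k\ge 0$, $\begin{bmatrix} n\\ k\end{bmatrix}_q=\prod_{i=1}^{k}\frac{q^{n-k+i}-1}{q^i-1}$ is the Gaussian binomial coefficient (the number of $k$-dimensional subspaces of $F_q^n$). A tree decomposition of a graph $\Gamma$ is a pair $(T,(B_x)_{x\in V(T)})$ with $T$ a tree and $B_x\subseteq V(\Gamma)$ such that every edge of $\Gamma$ lies in some $B_x$, and for each vertex $v$ of $\Gamma$ the set $\{x\in V(T): v\in B_x\}$ is nonempty and induces a connected subgraph of $T$; its width is $\max_x |B_x|-1$, and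 the treewidth $\operatorname{tw}(\Gamma)$ is the minimum width of a tree decomposition of $\Gamma$. *)

(* Defs.v *)
From HB Require Import structures.
From mathcomp Require Import all_boot all_order all_algebra.
From mathcomp Require Import boolp.

Set Implicit Arguments.
Unset Strict Implicit.
Unset Printing Implicit Defensive.

Import Order.TTheory GRing.Theory Num.Theory.
Local Open Scope ring_scope.

(* A simple graph on a finite type is given by its adjacency relation. *)

Section Trees.
Variables (T : finType) (e : rel T).

Definition simple_graph := symmetric e /\ irreflexive e.

(* A cycle of length 2 only goes back and forth along one edge, so it is not a
   cycle of a simple graph. *)
Definition acyclic_graph := forall c : seq T, (2 < size c)%N -> ~ ucycle e c.

Definition connected_on (A : {set T}) :=
  forall x y, x \in A -> y \in A ->
    connect [rel u v | [&& u \in A, v \in A & e u v]] x y.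

Definition is_tree :=
  [/\ simple_graph, (0 < #|T|)%N, connected_on [set: T] & acyclic_graph].

End Trees.

Record tree_decomposition (V : finType) (e : rel V) := TreeDecomposition {
  td_node : finType;
  td_adj : rel td_node;
  td_bag : td_node -> {set V};
  td_tree : is_tree td_adj;
  td_edge : forall u v, e u v -> exists x, (u \in td_bag x) && (v \in td_bag x);
  td_cover : forall v, exists x, v \in td_bag x;
  td_connected : forall v, connected_on td_adj [set x | v \in td_bag x] }.

Section Treewidth.
Variables (V : finType) (e : rel V).

Definition max_bag (D : tree_decomposition e) : nat :=
  (\max_(x : td_node D) #|td_bag x|)%N.

(* Integer-valued: the graph without vertices has a decomposition of
   width -1. *)
Definition width (D : tree_decomposition e) : int := (max_bag D)%:Z - 1.

Lemma exists_tree_decomposition :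
  exists m, `[< exists D : tree_decomposition e, max_bag D = m >].
Proof.
suff D : tree_decomposition e by exists (max_bag D); apply/asboolP; exists D.
have treeP : is_tree (fun _ _ : unit => false).
  split; [by [] | by rewrite card_unit | by move=> [] [] _ _; exact: connect0 |].
  by move=> [|[] [|[] c]].
apply: (TreeDecomposition (td_bag := fun=> [set: V]) treeP).
- by move=> u v _; exists tt; rewrite !inE.
- by move=> v; exists tt; rewrite inE.
- by move=> v [] [] _ _; exact: connect0.
Qed.

Definition treewidth : int := (ex_minn exists_tree_decomposition)%:Z - 1.

Lemma treewidthP :
  (exists D : tree_decomposition e, width D = treewidth) /\
  (forall D : tree_decomposition e, treewidth <= width D).
Proof.
rewrite /treewidth; case: ex_minnP => m /asboolP[D Dm] min_m; split.
  by exists D; rewrite /width Dm.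
move=> D'; rewrite /width lerD2r lez_nat; apply: min_m.
by apply/asboolP; exists D'.
Qed.

End Treewidth.

Section FiniteSubspaces.
Import VectorInternalTheory.
Variables (F : finFieldType) (vT : vectType F).
HB.instance Definition _ := [Countable of {vspace vT} by <:].
HB.instance Definition _ := [Finite of {vspace vT} by <:].
End FiniteSubspaces.

Definition subspace_of_dim (F : finFieldType) (n k : nat) :=
  {U : {vspace 'rV[F]_n} | \dim U == k}.

Definition qKneser (F : finFieldType) (n k t : nat) :
    rel (subspace_of_dim F n k) :=
  fun U1 U2 => (\dim (val U1 :&: val U2) < t)%N.

Lemma qKneser_simple (F : finFieldType) (n k t : nat) :
  (t <= k)%N -> simple_graph (@qKneser F n k t).
Proof.
move=> le_tk; split=> [U1 U2|U]; first by rewrite /qKneser capvC.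
by rewrite /qKneser capvv (eqP (valP U)) ltnNge le_tk.
Qed.

(* Only meaningful for k <= n, where the truncated n - k is exact. *)
Definition gauss_binomial (q n k : nat) : rat :=
  \prod_(1 <= i < k.+1) ((q%:R ^+ (n - k + i) - 1) / (q%:R ^+ i - 1)).

(* Only meaningful for prime powers q. *)
Definition epsilon (q : nat) : nat :=
  if q == 2 then 9
  else if q == 3 then 3
  else if q == 4 then 2
  else if (q <= 8)%N then 1
  else 0.

(* Main.v *)
(* Upper bound: all [k]-spaces through a fixed [t]-space form an independent set
   [I] of size [n-t, k-t]; take a star whose centre carries the complement of [I]
   and whose leaves carry the closed neighbourhoods of the members of [I].

   Lower bound: suppose that every bag [B] has fewer than [|V| - |I|] vertices.  By
   the Erdos-Ko-Rado theorem the complement of [B] contains an edge [b b'].  A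
   vertex adjacent to neither [b] nor [b'] meets both in dimension at least [t],
   although [dim (b :&: b') < t]; counting shows that at most [|I| / 2] vertices do,
   which is where conditions (1) and (2) enter.  Hence the component of [b b']
   outside [B] has more than half of the vertices outside [B], any two such
   components touch, and they form a bramble that no bag covers.

   The Erdos-Ko-Rado theorem for [n >= 2k] is proved as by Frankl and Wilson, with
   a symmetric matrix supported on the edges, whose eigenspaces come from the
   harmonic functions on [e]-dimensional subspaces, [0 <= e <= k]. *)

Require Import Defs.
From mathcomp Require Import all_boot all_order all_algebra.
From mathcomp Require Import finfield boolp zify ring lra.

Set Implicit Arguments.
Unset Strict Implicit.
Unset Printing Implicit Defensive.

Import Order.TTheory GRing.Theory Num.Theory.
Local Open Scope ring_scope.

(** * Trees and treewidth *)

(** Conditions (1) and (2) are one statement about a quadratic. The common non-neighbours of an edge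
    are counted by a sum over [i >= 1] whose [i]-th term is at most [c^3 q^-(i^2 + iN + t) |I|],
    where [N = n - 3k + t - 1]. The conditions put the exponent [i^2 + iN + t] at [epsilon q + 1] or
    more for every positive integer [i], and [epsilon] absorbs the constant and the geometric series
    around the minimum. The Frankl-Wilson matrix is the identity plus a combination, over [i < t],
    of the numbers of [(k-i)]-spaces of [a] disjoint from [b]; these vanish on pairs that are not
    edges. The [t] coefficients are chosen so that each row sums to 1 over the [k]-spaces through
    any [t]-space. This settles degrees up to [t] exactly; the obstacle is the sign of the
    eigenvalues in higher degrees. They are alternating sums, and the crude estimates must still
    work at [q = 2]: the negative terms add up to at most 80/81 in absolute value, against the 1 of
    the identity. *)

Section TreeSeparation.
Variables (T : finType) (e : rel T).
Hypothesis treeP : is_tree e.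

Definition avoiding x : rel T := [rel u v | [&& u != x, v != x & e u v]].

(** Paths that avoid [x] or avoid [y] never use the edge [x y], so joining them at [z] gives a
    second route from [x] to [y], which that edge closes into a cycle. *)
Lemma tree_edge_separates x y z :
  e x y -> connect (avoiding x) y z -> connect (avoiding y) x z -> False.
Proof.
case: treeP => -[esym eirr] _ _ eacyc exy yz xz.
have nxy : x != y by apply: contraTneq exy => ->; rewrite eirr.
pose e' := [rel u v | e u v && ((u, v) \notin [:: (x, y); (y, x)])].
have e'sym : symmetric e'.
  move=> u v; rewrite /= esym; congr (_ && ~~ _).
  by rewrite !inE !xpair_eqE orbC [(u == y) && _]andbC [(u == x) && _]andbC.
have sub_x : subrel (avoiding x) (connect e').
  move=> u v /and3P[ux vx euv]; apply: connect1; rewrite /= euv !inE !xpair_eqE.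
  by rewrite (negbTE ux) (negbTE vx) andbF.
have sub_y : subrel (avoiding y) (connect e').
  move=> u v /and3P[uy vy euv]; apply: connect1; rewrite /= euv !inE !xpair_eqE.
  by rewrite (negbTE uy) (negbTE vy) andbF.
have : connect e' x y.
  apply: connect_trans (connect_sub sub_y xz) _.
  by rewrite (sym_connect_sym e'sym); apply: connect_sub sub_x _ _ yz.
case/connectP=> p; case/shortenP=> p' path_p' uniq_p' _ last_p'.
apply: (eacyc (x :: p')).
  case: p' path_p' last_p' {uniq_p'} => [|a [|b p']] //=.
    by move=> _ ey; rewrite ey eqxx in nxy.
  by rewrite andbT => /andP[_ h] ea; move: h; rewrite -ea !inE eqxx.
rewrite /ucycle uniq_p' /= rcons_path andbT -last_p' esym exy andbT.
by apply: sub_path path_p' => u v /andP[].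
Qed.

Lemma tree_step x z : x != z ->
  exists y, e x y && connect (avoiding x) y z.
Proof.
case: treeP => _ _ econn _ nxz.
have := econn x z; rewrite !inE => /(_ isT isT)/connectP[p].
case/shortenP=> -[|y p'] path_p' uniq_p' _ /= last_p'.
  by rewrite last_p' eqxx in nxz.
move: path_p' => /= /andP[/and3P[_ _ exy] path_p']; exists y; rewrite exy /=.
apply/connectP; exists p' => //.
have xNp : x \notin y :: p' by case/andP: uniq_p'.
elim: p' y xNp path_p' {exy uniq_p' last_p'} => [//|b p' IHp] y xNp /=.
move=> /andP[/and3P[_ _ eyb] path_p'].
move: xNp; rewrite !inE !negb_or => /and3P[xy xb xp].
apply/andP; split; first by rewrite /avoiding /= eq_sym xy eq_sym xb.
apply: IHp => //.
by rewrite inE negb_or xb.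
Qed.

(* The first steps towards [S x] form a map on nodes; following it round an
   orbit shows, as a tree has no cycles, that it swaps two adjacent nodes. *)
Lemma tree_no_escape (S : T -> {set T}) :
    (forall x, x \notin S x) ->
    (forall x, {in S x &, forall u v, connect (avoiding x) u v}) ->
    (forall x y, S x :&: S y != set0) -> False.
Proof.
case: (treeP) => -[esym eirr] T0 _ eacyc xNS Sconn Smeet.
have stepP x : exists y, e x y &&
    [exists z, (z \in S x) && connect (avoiding x) y z].
  have /set0Pn[z] := Smeet x x; rewrite setIid => zS.
  have [|y /andP[exy yz]] := @tree_step x z.
    by apply: contraNneq (xNS x) => xz; rewrite {1}xz.
  by exists y; rewrite exy; apply/existsP; exists z; rewrite zS.
pose s x := xchoose (stepP x).
have es x : e x (s x) by case/andP: (xchooseP (stepP x)).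
have sS x : exists2 z, z \in S x & connect (avoiding x) (s x) z.
  by case/andP: (xchooseP (stepP x)) => _ /existsP[z /andP[]]; exists z.
have sSw x w : w \in S x -> connect (avoiding x) (s x) w.
  move=> wS; have [z zS sz] := sS x.
  exact: connect_trans sz (Sconn x _ _ zS wS).
(* A node shared by [S x] and [S (s x)] would lie on both sides of the edge from [x] to [s x]. *)
have nosw x : s (s x) <> x.
  move=> ssx; have /set0Pn[z /setIP[zx zy]] := Smeet x (s x).
  apply: (@tree_edge_separates x (s x) z (es x) (sSw _ _ zx)).
  by have := sSw _ _ zy; rewrite ssx.
have /card_gt0P[x0 _] := T0.
have loop : looping s x0 #|T|.
  apply/negPn/negP; rewrite -looping_uniq => u.
  have := max_card (mem (traject s x0 #|T|.+1)).
  by rewrite (card_uniqP u) size_traject ltnn.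
have /trajectP[i lti Ei] := loop.
pose y := iter i s x0; pose m := (#|T| - i)%N.
have Em : iter m s y = y by rewrite /y -iterD subnK ?Ei // ltnW.
have Pm : exists m, (0 < m)%N && (iter m s y == y).
  by exists m; rewrite Em eqxx subn_gt0 lti.
(* Minimality of the period [l] makes the orbit free of repetitions; [l] exceeds 2 because [s] fixes
   no node and swaps no two. *)
case: (ex_minnP Pm) => l /andP[l0 /eqP El] lmin.
have lt2 : (2 < l)%N.
  case: l l0 El lmin => [|[|[|l]]] //= _ El _.
    by have := es y; rewrite El eirr.
  by case: (nosw y).
apply: (eacyc (traject s y l)); first by rewrite size_traject.
rewrite /ucycle; apply/andP; split.
  case: l l0 El {lmin lt2} => // l _ El.
  rewrite trajectS /= rcons_path last_traject.
  have -> : e (iter l s y) y by rewrite -{2}El /=; apply: es.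
  rewrite andbT; elim: l (y) {El} => //= l IH w; rewrite es; exact: IH.
case: l l0 El lmin {lt2} => // l _ El lmin.
rewrite looping_uniq; apply/negP => /trajectP[j ltj Ej].
have [n0 /andP[n0l En]] : exists n0, (0 < n0 <= l)%N && (iter n0 s y == y).
  exists (l - j)%N; rewrite subn_gt0 ltj leq_subr /=.
  apply/eqP; rewrite -{1}El -iterD.
  have -> : (l - j + l.+1)%N = ((l - j).+1 + l)%N by lia.
  by rewrite iterD Ej -iterD -{2}El; congr (iter _ s y); lia.
case/andP: n0l => n0_gt0 n0l.
have := lmin _ (introT andP (conj n0_gt0 En)); lia.
Qed.

End TreeSeparation.

Section TreewidthLowerBound.
Variables (V : finType) (e : rel V) (alpha beta : nat).
Hypothesis esym : symmetric e.
Hypothesis edge_in_large : forall A : {set V}, (alpha < #|A|)%N ->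
  exists u v, [/\ u \in A, v \in A & e u v].
Hypothesis few_nonneighbors : forall u v, e u v ->
  (#|[set w | ~~ e u w & ~~ e v w]| <= beta)%N.
Hypothesis beta_small : (2 * beta <= alpha)%N.

Let outside (B : {set V}) : rel V :=
  [rel u v | [&& u \notin B, v \notin B & e u v]].
Let comp B u : {set V} := [set v | connect (outside B) u v].

Let outside_sym B : connect_sym (outside B).
Proof.
apply: sym_connect_sym => u v; rewrite /outside /= [e u v]esym.
by case: (u \in B); case: (v \in B).
Qed.

(** If all bags were too small, the sets [S x] of nodes whose bag meets the component [C x] would
    contradict [tree_no_escape]: [S x] misses [x], is connected away from [x], and any two meet
    because the components touch. *)
Lemma max_bag_ge (D : tree_decomposition e) : (#|V| <= max_bag D + alpha)%N.
Proof.
rewrite leqNgt; apply/negP => small.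
have bagsize (x : td_node D) : (#|td_bag x| <= max_bag D)%N.
  exact: (@leq_bigmax _ (fun x : td_node D => #|td_bag x|)).
have big (x : td_node D) : exists uv : V * V,
    [&& uv.1 \notin td_bag x, uv.2 \notin td_bag x & e uv.1 uv.2].
  have [|u [v [uB vB euv]]] := @edge_in_large (~: td_bag x).
    by rewrite cardsCs setCK; have := bagsize x; lia.
  by exists (u, v); move: uB vB; rewrite !inE /= => -> ->.
pose b x := (xchoose (big x)).1; pose b' x := (xchoose (big x)).2.
have bP x : [/\ b x \notin td_bag x, b' x \notin td_bag x & e (b x) (b' x)].
  by have /and3P := xchooseP (big x).
pose C x := comp (td_bag x) (b x).
have bC x : b x \in C x by rewrite inE connect0.
have CNB x u : u \in C x -> u \notin td_bag x.
  have [bB _ _] := bP x.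
  rewrite inE => /connectP[p]; elim/last_ind: p => [_ -> //|p w _].
  by rewrite rcons_path last_rcons => /andP[_ /and3P[_ wB _]] ->.
have C_edge x u v : u \in C x -> v \notin td_bag x -> e u v -> v \in C x.
  move=> uC vB euv; have uB := CNB _ _ uC; move: uC; rewrite !inE => bu.
  by apply: connect_trans bu (connect1 _); rewrite /outside /= uB vB.
have b'C x : b' x \in C x.
  by have [bB b'B ebb] := bP x; apply: C_edge ebb.
(* A vertex outside the bag that is adjacent to [b x] or [b' x] lies in [C x], so [C x] has more
   than [alpha - beta >= beta] elements. *)
have Cbig x : (beta < #|C x|)%N.
  have sub : ~: td_bag x \subset
      C x :|: [set w | ~~ e (b x) w & ~~ e (b' x) w].
    apply/subsetP => w; rewrite in_setC => wB.
    rewrite in_setU; case: (boolP (w \in C x)) => //= wC; rewrite inE.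
    by apply/andP; split; apply: contra wC; apply: C_edge.
  have := subset_leq_card sub; rewrite cardsCs setCK.
  have [_ _ ebb] := bP x; have := few_nonneighbors ebb.
  have := cardsU (C x) [set w | ~~ e (b x) w & ~~ e (b' x) w].
  have := bagsize x; lia.
(* More than [beta] vertices of [C y] cannot all be common non-neighbours of [b x] and [b' x]. *)
have touch x y : exists u v, [/\ u \in C x, v \in C y & (u == v) || e u v].
  have [_ _ ebb] := bP x; have few := few_nonneighbors ebb.
  have /subsetPn[v vC] :
      ~~ (C y \subset [set w | ~~ e (b x) w & ~~ e (b' x) w]).
    apply/negP => /subset_leq_card h; have := Cbig y; lia.
  rewrite inE negb_and !negbK => /orP[h|h].
    by exists (b x), v; rewrite h orbT.
  by exists (b' x), v; rewrite h orbT.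
pose S (x : td_node D) := [set y : td_node D | [exists u in C x, u \in td_bag y]].
have sub_avoid x u : u \in C x ->
    {in [set y | u \in td_bag y] &, forall y z,
      connect (avoiding (td_adj (t:=D)) x) y z}.
  move=> uC y z yB zB; apply: connect_sub (td_connected yB zB) => v w.
  move=> /and3P[vB wB evw]; apply: connect1; rewrite /avoiding /= evw andbT.
  move: vB wB; rewrite !inE => vB wB.
  by apply/andP; split; apply: contraTneq (CNB _ _ uC) => <-; rewrite negbK.
apply: (tree_no_escape (td_tree D) (S := S)).
- move=> x; rewrite inE; apply/exists_inP => -[u uC uB].
  by have := CNB _ _ uC; rewrite uB.
(* Follow a path from [u] to [v] in [C x]: consecutive vertices share a bag, and the nodes holding
   one vertex of [C x] are connected without passing through [x]. *)
- move=> x y z; rewrite !inE => /exists_inP[u uC uy] /exists_inP[v vC vz].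
  have uv : connect (outside (td_bag x)) u v.
    move: uC vC; rewrite !inE => uC vC.
    by apply: connect_trans vC; rewrite outside_sym.
  case/connectP: uv => p; elim: p u uC y uy => [|w p IHp] u uC y uy /=.
    by move=> _ Ev; apply: (sub_avoid x u uC); rewrite inE // -Ev.
  move=> /andP[/and3P[_ wB euw] path_p] Ev.
  have wC : w \in C x by apply: C_edge uC wB euw.
  have [y' /andP[uy' wy']] := td_edge D euw.
  apply: connect_trans (IHp w wC y' wy' path_p Ev).
  by apply: (sub_avoid x u uC); rewrite inE.
move=> x y; have [u [v [uC vC /orP[/eqP Euv|euv]]]] := touch x y.
  move: vC; rewrite -Euv => vC.
  have [z uz] := td_cover D u; apply/set0Pn; exists z; rewrite !inE.
  by apply/andP; split; apply/exists_inP; exists u.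
have [z /andP[uz vz]] := td_edge D euv; apply/set0Pn; exists z; rewrite !inE.
by apply/andP; split; apply/exists_inP; [exists u | exists v].
Qed.

End TreewidthLowerBound.

(** * The star decomposition attached to an independent set *)

Section StarDecomposition.
Variables (V : finType) (e : rel V) (I : {set V}).
Hypothesis esym : symmetric e.
Hypothesis I_indep : {in I &, forall u v, ~~ e u v}.
Hypothesis I_nonneighbor :
  forall u, u \in I -> exists2 w, w \notin I & ~~ e u w.

Let star : rel (option V) := [rel x y | (x == None) (+) (y == None)].
(** [None] is the centre. Vertices outside [I] also get a leaf, with an empty bag, so that the node
    type is all of [option V]. *)
Let bag (x : option V) : {set V} :=
  if x is Some u then
    (if u \in I then u |: [set v | e u v] else set0)
  else ~: I.

Let star_tree : is_tree star.
Proof.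
split; first by split=> [x y|x]; rewrite /star /= ?addbb // addbC.
- by rewrite card_option.
- have h (x : option V) : connect
    [rel u v | [&& u \in [set: option V], v \in [set: option V] & star u v]]
     x None.
    case: x => [u|]; last exact: connect0.
    by apply: connect1; rewrite /= !inE.
  have hs : connect_sym
    [rel u v | [&& u \in [set: option V], v \in [set: option V] & star u v]].
    by apply: sym_connect_sym => x y; rewrite /star /= !inE addbC.
  by move=> x y _ _; apply: connect_trans (h x) _; rewrite hs.
move=> [|x [|y [|z c]]] // _ /andP[].
rewrite [cycle _ _]/= => /and3P[xy yz zc] /=.
rewrite !inE !negb_or => /andP[/and3P[nxy nxz xc] /andP[/andP[nyz yc] _]].
(* Closed walks alternate between centre and leaves, so one of length at least 3 visits the centre
   twice. *)
case: x y z xy yz zc nxy nxz xc nyz yc => [x|] [y|] [z|] //= _ _ zc _ _ _ _ yc.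
by case: c zc yc => [|[w|] c] //=; rewrite ?inE.
Qed.

Lemma star_decomposition :
  exists D : tree_decomposition e, (max_bag D <= #|V| - #|I|)%N.
Proof.
have edgeP u v : e u v -> exists x, (u \in bag x) && (v \in bag x).
  move=> euv; case: (boolP (u \in I)) => uI.
    by exists (Some u); rewrite /= uI !inE eqxx euv orbT.
  case: (boolP (v \in I)) => vI.
    by exists (Some v); rewrite /= vI !inE eqxx esym euv orbT.
  by exists None; rewrite !inE uI vI.
have coverP v : exists x, v \in bag x.
  case: (boolP (v \in I)) => vI; last by exists None; rewrite inE.
  by exists (Some v); rewrite /= vI !inE eqxx.
have connP v : connected_on star [set x | v \in bag x].
  case: (boolP (v \in I)) => vI.
    have h x : x \in [set x | v \in bag x] -> x = Some v.
      case: x => [u|]; rewrite inE /=; last by rewrite inE vI.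
      case: ifP => uI; rewrite !inE // => /orP[/eqP-> //|euv].
      by have := I_indep uI vI; rewrite euv.
    by move=> x y /h-> /h->; exact: connect0.
  pose B := [set x | v \in bag x].
  pose r := [rel x y | [&& x \in B, y \in B & star x y]].
  have h x : x \in B -> connect r x None.
    case: x => [u|] uB; last exact: connect0.
    by apply: connect1; rewrite /r /= uB !inE vI.
  have hs : connect_sym r.
    by apply: sym_connect_sym => x y; rewrite /r /star /= andbCA addbC.
  by move=> x y xB yB; apply: connect_trans (h _ xB) _; rewrite hs; apply: h.
exists (TreeDecomposition star_tree edgeP coverP connP).
rewrite /max_bag /=; apply/bigmax_leqP => -[u|] _ /=; last first.
  by rewrite cardsCs setCK.
case: ifP => uI; last by rewrite cards0.
(* The neighbours of [u] lie outside [I] and miss [w], which leaves room for [u] itself. *)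
have [w wI euw] := I_nonneighbor uI.
have sub : [set v | e u v] \subset (~: I) :\ w.
  apply/subsetP => v; rewrite !inE => euv; apply/andP; split.
    by apply: contraNneq euw => <-.
  by apply: contraTN euv => vI; apply: I_indep.
have := subset_leq_card sub.
have := cardsD1 w (~: I); rewrite inE wI [#|~: I|]cardsCs setCK => -> le.
have := cardsU1 u [set v | e u v]; lia.
Qed.

End StarDecomposition.

Theorem treewidth_of_star (V : finType) (e : rel V) (I : {set V}) (beta : nat) :
    simple_graph e ->
    {in I &, forall u v, ~~ e u v} ->
    (forall u, u \in I -> exists2 w, w \notin I & ~~ e u w) ->
    (forall A : {set V}, {in A &, forall u v, ~~ e u v} -> (#|A| <= #|I|)%N) ->
    (forall u v, e u v -> (#|[set w | ~~ e u w & ~~ e v w]| <= beta)%N) ->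
    (2 * beta <= #|I|)%N ->
  treewidth e = #|V|%:Z - #|I|%:Z - 1.
Proof.
move=> [esym eirr] indepI nonnbr maxI few small.
rewrite /treewidth; case: ex_minnP => m /asboolP[D Dm] minm; congr (_ - 1).
have [D' D'le] := star_decomposition esym indepI nonnbr.
have le1 : (m <= #|V| - #|I|)%N.
  by apply: leq_trans D'le; apply: minm; apply/asboolP; exists D'.
have le2 : (#|V| <= m + #|I|)%N.
  rewrite -Dm; apply: (max_bag_ge esym _ few small).
  move=> A; rewrite ltnNge => /negP AI.
  have /existsP[u /existsP[v /and3P[uA vA euv]]] :
      [exists u, exists v, [&& u \in A, v \in A & e u v]].
    apply: contraT => /existsPn h; case: AI; apply: maxI => u v uA vA.
    apply: contra (h u) => euv.
    by apply/existsP; exists v; rewrite uA vA.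
  by exists u, v.
have leIV : (#|I| <= #|V|)%N := max_card _; lia.
Qed.

(** * Gaussian binomial coefficients *)

Lemma bin2D i j : 'C(i + j, 2) = ('C(i, 2) + 'C(j, 2) + i * j)%N.
Proof.
elim: i => [|i IHi]; first by rewrite mul0n addn0.
by rewrite addSn !binS !bin1 IHi; lia.
Qed.

Section QBinomial.
Variables (K : realFieldType) (x : K).

(** This is the q-factorial times [(x - 1) ^+ m]; the extra power cancels in [qbin]. *)
Definition qfact m : K := \prod_(l < m) (x ^+ l.+1 - 1).

Definition qbin m j : K :=
  if (j <= m)%N then qfact m / (qfact j * qfact (m - j)) else 0.

Hypothesis x_gt1 : 1 < x.

Let x_gt0 : 0 < x. Proof. exact: lt_trans x_gt1. Qed.
Let x_neq0 : x != 0. Proof. exact: lt0r_neq0. Qed.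

Lemma expr_sub1_gt0 l : 0 < x ^+ l.+1 - 1.
Proof. by rewrite subr_gt0 exprn_egt1. Qed.

Lemma expr_sub1_neq0 l : x ^+ l.+1 - 1 != 0.
Proof. exact/lt0r_neq0/expr_sub1_gt0. Qed.

Lemma qfactS m : qfact m.+1 = qfact m * (x ^+ m.+1 - 1).
Proof. exact: big_ord_recr. Qed.

Lemma qfact_gt0 m : 0 < qfact m.
Proof. by apply: prodr_gt0 => i _; exact: expr_sub1_gt0. Qed.

Lemma qfact_neq0 m : qfact m != 0.
Proof. exact/lt0r_neq0/qfact_gt0. Qed.

Lemma qbinE a b : qbin (a + b) a = qfact (a + b) / (qfact a * qfact b).
Proof. by rewrite /qbin leq_addr addKn. Qed.

Lemma qbin_add m a b : m = (a + b)%N -> qbin m a = qfact m / (qfact a * qfact b).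
Proof. by move=> ->; exact: qbinE. Qed.

Lemma qbin_small m j : (m < j)%N -> qbin m j = 0.
Proof. by rewrite /qbin ltnNge => /negbTE->. Qed.

Lemma qbin_ge0 m j : 0 <= qbin m j.
Proof.
by rewrite /qbin; case: ifP => // _; rewrite divr_ge0 ?mulr_ge0 // ltW // qfact_gt0.
Qed.

Lemma qbin_gt0 m j : (j <= m)%N -> 0 < qbin m j.
Proof. by move=> jm; rewrite /qbin jm divr_gt0 ?mulr_gt0 // qfact_gt0. Qed.

Lemma qbin0 m : qbin m 0 = 1.
Proof. by rewrite -[m]add0n qbinE /qfact big_ord0 mul1r divff // qfact_neq0. Qed.

Lemma qbin_sym a b : qbin (a + b) a = qbin (a + b) b.
Proof. by rewrite qbinE addnC qbinE [qfact a * _]mulrC. Qed.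

Lemma qbinnn m : qbin m m = 1.
Proof. by rewrite -{1}[m]addn0 qbin_sym qbin0. Qed.

Lemma qbin_succ m j :
  qbin m.+1 j.+1 = (x ^+ m.+1 - 1) / (x ^+ j.+1 - 1) * qbin m j.
Proof.
have [|lt_mj] := leqP j m; last by rewrite !qbin_small ?mulr0.
move=> /subnKC <-; set b := (m - j)%N; rewrite -addSn !qbinE addSn !qfactS.
have := qfact_neq0 j; have := qfact_neq0 b; have := expr_sub1_neq0 j.
by move=> *; field; apply/and3P.
Qed.

Lemma qbin_pascal m j : qbin m.+1 j.+1 = qbin m j + x ^+ j.+1 * qbin m j.+1.
Proof.
have [lt_jm|] := ltnP j m; last first.
  rewrite leq_eqVlt => /predU1P[->|lt_mj]; last first.
    by rewrite !qbin_small ?mulr0 ?addr0 // ltnW.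
  by rewrite !qbinnn qbin_small ?mulr0 ?addr0.
have [b Em] : exists b, m = (j + b).+1 by exists (m - j.+1)%N; lia.
rewrite (@qbin_add _ _ b.+1) ?(@qbin_add _ j b.+1) ?(@qbin_add _ _ b); try lia.
rewrite Em !qfactS.
have -> : x ^+ (j + b).+2 = x ^+ j.+1 * x ^+ b.+1.
  by rewrite -exprD; congr (_ ^+ _); lia.
have := qfact_neq0 j; have := qfact_neq0 b; have := expr_sub1_neq0 j.
have := expr_sub1_neq0 b.
by move=> h1 h2 h3 h4; field; rewrite h1 h2 h3 h4.
Qed.

Lemma qbin_pascal_r m j : (j <= m)%N ->
  qbin m.+1 j.+1 = x ^+ (m - j) * qbin m j + qbin m j.+1.
Proof.
rewrite leq_eqVlt => /predU1P[->|lt_jm].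
  by rewrite !qbinnn qbin_small // subnn mulr1 addr0.
have [b Em] : exists b, m = (j + b).+1 by exists (m - j.+1)%N; lia.
rewrite (@qbin_add _ _ b.+1) ?(@qbin_add _ j b.+1) ?(@qbin_add _ _ b); try lia.
have -> : (m - j = b.+1)%N by lia.
rewrite Em !qfactS.
have -> : x ^+ (j + b).+2 = x ^+ j.+1 * x ^+ b.+1.
  by rewrite -exprD; congr (_ ^+ _); lia.
have := qfact_neq0 j; have := qfact_neq0 b; have := expr_sub1_neq0 j.
have := expr_sub1_neq0 b.
by move=> h1 h2 h3 h4; field; rewrite h1 h2 h3 h4.
Qed.

(** For a prime power [x], both sides count the flags of dimensions [a] and [a + b] in a space of
    dimension [a + b + c]. *)
Lemma qbin_trinomial a b c :
  qbin (a + b + c) a * qbin (b + c) b = qbin (a + b + c) (a + b) * qbin (a + b) a.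
Proof.
rewrite -addnA qbinE qbinE addnA !qbinE.
have := qfact_neq0.
move=> h; have ha := h a; have hb := h b; have hc := h c.
have hab := h (a + b)%N; have hbc := h (b + c)%N.
by field; rewrite ha hb hc hab hbc.
Qed.

(** This is the q-binomial expansion of the product of the [1 - x ^+ i], [0 <= i <= m], whose first
    factor is zero. Pascal's rule makes the sum telescope. *)
Lemma qbin_alternating_sum m :
  \sum_(j < m.+2) (-1) ^+ j * x ^+ 'C(j, 2) * qbin m.+1 j = 0.
Proof.
pose a j : K := (-1) ^+ j * x ^+ 'C(j.+1, 2) * qbin m j.
have aE j : (-1) ^+ j.+1 * x ^+ 'C(j.+1, 2) * qbin m.+1 j.+1 = a j.+1 - a j.
  by rewrite qbin_pascal /a [in RHS]binS bin1 exprD exprS; ring.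
rewrite big_ord_recl /= (eq_bigr (fun j : 'I_m.+1 => a j.+1 - a j)); last first.
  by move=> j _; exact: aE.
rewrite -(big_mkord xpredT (fun j => a j.+1 - a j)) telescope_sumr //.
by rewrite /a !qbin0 qbin_small // !expr0; ring.
Qed.

(* The weights of the Frankl-Wilson matrix solve a triangular linear system;
   this is its solution. *)
Lemma qbin_frankl_wilson N m :
  \sum_(j < N.+1) (-1) ^+ (N - j) *
     x ^- ('C(N.+1 - j, 2) + j * (N.+1 + m - j) + (N - j) * m)
     * qbin (N.+1 + m) j * qbin (N + m - j) (N - j) = 1.
Proof.
elim: N => [|N IHN].
  by rewrite big_ord_recl big_ord0 /= !qbin0 !mul0n !expr0 invr1; ring.
pose w (j : nat) : K := (-1) ^+ (N.+1 - j) *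
     x ^- ('C(N.+2 - j, 2) + j * (N.+2 + m - j) + (N.+1 - j) * m)
     * qbin (N.+1 + m - j) (N.+1 - j).
(* Pascal's rule splits the sum in two: the first part is the sum for [N], and by the trinomial
   identity the second is a constant multiple of [qbin_alternating_sum]. *)
have -> : \sum_(j < N.+2) (-1) ^+ (N.+1 - j) *
     x ^- ('C(N.+2 - j, 2) + j * (N.+2 + m - j) + (N.+1 - j) * m)
     * qbin (N.+2 + m) j * qbin (N.+1 + m - j) (N.+1 - j) =
   \sum_(j < N.+1) w j.+1 * x ^+ (N.+1 + m - j) * qbin (N.+1 + m) j +
   \sum_(j < N.+2) w j * qbin (N.+1 + m) j.
  rewrite big_ord_recl [\sum_(j < N.+2) w _ * _]big_ord_recl /= addrCA.
  congr (_ + _); first by rewrite /w !qbin0 !mulr1.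
  rewrite -big_split /=; apply: eq_bigr => j _.
  rewrite /bump leq0n add1n.
  have p : qbin (N.+2 + m) j.+1 =
      x ^+ (N.+1 + m - j) * qbin (N.+1 + m) j + qbin (N.+1 + m) j.+1.
    by apply: (@qbin_pascal_r (N.+1 + m)); have := ltn_ord j; lia.
  by rewrite p /w; ring.
rewrite [X in _ + X](_ : _ = 0) ?addr0.
  rewrite -[RHS]IHN; apply: eq_bigr => j _; rewrite /w.
  have -> : ('C(N.+2 - j.+1, 2) + j.+1 * (N.+2 + m - j.+1) + (N.+1 - j.+1) * m
    = 'C(N.+1 - j, 2) + j * (N.+1 + m - j) + (N - j) * m + (N.+1 + m - j))%N.
    have -> : (N.+2 + m - j.+1 = N.+1 + m - j)%N by lia.
    by rewrite !subSS mulSn; lia.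
  have -> : (N.+1 + m - j.+1 = N + m - j)%N by lia.
  rewrite !subSS exprD invfM; set u := x ^+ (N.+1 + m - j).
  have u0 : u != 0 by rewrite expf_neq0.
  set p := (x ^+ _)^-1; set sg := (-1) ^+ _; set B1 := qbin _ _; set B2 := qbin _ _.
  by clearbody u p sg B1 B2; field.
transitivity (\sum_(j < N.+2) ((-1) ^+ N.+1 *
    x ^- (N.+1 * m.+1 + 'C(N.+1, 2)) * qbin (N.+1 + m) N.+1) *
    ((-1) ^+ j * x ^+ 'C(j, 2) * qbin N.+1 j)); last first.
  by rewrite -mulr_sumr qbin_alternating_sum mulr0.
apply: eq_bigr => j _; rewrite /w.
move: (nat_of_ord j) (leq_ord j) => {}j ltj.
have trin : qbin (N.+1 + m) j * qbin (N.+1 + m - j) (N.+1 - j) =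
    qbin (N.+1 + m) N.+1 * qbin N.+1 j.
  have := qbin_trinomial j (N.+1 - j) m; rewrite subnKC // => <-.
  by rewrite addnBAC.
have sgn : (-1) ^+ (N.+1 - j) = (-1) ^+ N.+1 * (-1) ^+ j :> K.
  by rewrite -signr_odd oddB // signr_addb !signr_odd.
have -> : x ^- ('C(N.+2 - j, 2) + j * (N.+2 + m - j) + (N.+1 - j) * m) =
   x ^- (N.+1 * m.+1 + 'C(N.+1, 2)) * x ^+ 'C(j, 2).
  have -> : (N.+1 * m.+1 + 'C(N.+1, 2) = 'C(N.+2 - j, 2) + j * (N.+2 + m - j)
      + (N.+1 - j) * m + 'C(j, 2))%N.
    have [i Ei] : exists i, (N.+1 = i + j)%N by exists (N.+1 - j)%N; lia.
    have -> : (N.+2 - j = i.+1)%N by lia.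
    have -> : (N.+2 + m - j = i.+1 + m)%N by lia.
    by rewrite Ei addnK bin2D binS bin1; lia.
  by rewrite [in RHS]exprD invfM mulfVK ?expf_neq0.
by rewrite sgn -[LHS]mulrA [qbin (N.+1 + m - j) _ * _]mulrC trin; ring.
Qed.

(* The constant starts the pentagonal number expansion of the infinite product of
   the [1 - x ^- l]. *)
Lemma qfact_lb m : 2 <= x ->
  x ^+ 'C(m.+1, 2) * (1 - x^-1 - x^-2 + x^-5) <= qfact m.
Proof.
move=> x2; set y := x^-1.
have y0 : 0 < y by rewrite invr_gt0.
have y2 : y <= 1 / 2 by rewrite mul1r lef_pV2 ?posrE.
have -> : 1 - y - x^-2 + x^-5 = (1 - y ^+ 2) * (1 - y - y ^+ 3).
  by rewrite -!exprVn -/y; ring.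
have step j : x ^+ j.+1 - 1 = x ^+ j.+1 * (1 - y ^+ j.+1).
  by rewrite mulrBr mulr1 /y exprVn mulfV ?expf_neq0.
suff lb j : (1 - y ^+ 2) * (1 - y - y ^+ 3) <= \prod_(l < j) (1 - y ^+ l.+1).
  have -> : qfact m = x ^+ 'C(m.+1, 2) * \prod_(l < m) (1 - y ^+ l.+1).
    elim: m => [|m IHm]; first by rewrite /qfact !big_ord0 bin_small ?expr0 ?mulr1.
    by rewrite qfactS IHm step big_ord_recr /= [in RHS]binS bin1 exprD; ring.
  by rewrite ler_pM2l ?exprn_gt0.
have y2_lt1 : y ^+ 2 < 1 by nra.
have y2_ge0 : 0 <= y ^+ 2 by rewrite exprn_ge0 ?ltW.
have y3_ge0 : 0 <= y ^+ 3 by rewrite exprn_ge0 ?ltW.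
case: j => [|[|r]].
- move: y2_lt1 y2_ge0 y3_ge0; rewrite big_ord0.
  by move: (y ^+ 2) (y ^+ 3) => a b *; nra.
- move: y2_lt1 y2_ge0 y3_ge0; rewrite big_ord_recr big_ord0 /= expr1 mul1r.
  by move: (y ^+ 2) (y ^+ 3) => a b *; nra.
(* The bare bound would not survive multiplication by another factor. The slack [y ^+ r.+3] closes
   the induction, which comes down to [y ^+ r.+3 <= y ^+ 3]. *)
suff : (1 - y ^+ 2) * (1 - y - y ^+ 3 + y ^+ r.+3) <=
    \prod_(l < r.+2) (1 - y ^+ l.+1).
  apply: le_trans; rewrite ler_pM2l ?subr_gt0 //.
  by rewrite lerDl exprn_ge0 // ltW.
elim: r => [|r IHr].
  by rewrite !big_ord_recr big_ord0 /= expr1; nra.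
rewrite big_ord_recr /=.
have z1 : y ^+ r.+3 <= 1 by rewrite exprn_ile1 ?ltW //; lra.
have zy3 : y ^+ r.+3 <= y ^+ 3.
  by rewrite -addn3 exprD ler_piMl ?exprn_ge0 ?exprn_ile1 ?ltW //; lra.
apply: le_trans (_ : (1 - y ^+ 2) * (1 - y - y ^+ 3 + y ^+ r.+3) *
    (1 - y ^+ r.+3) <= _); last by rewrite ler_wpM2r // subr_ge0.
rewrite -mulrA ler_pM2l ?subr_gt0 // [y ^+ r.+4]exprS.
have z0 : 0 <= y ^+ r.+3 by rewrite exprn_ge0 ?ltW.
by move: zy3 z1 z0; set z := y ^+ r.+3 => *; nra.
Qed.

(** In the numerator each factor [x ^+ l - 1] not cancelled by [qfact (m - j)] is replaced by
    [x ^+ l]; the remaining denominator [qfact j] is bounded by [qfact_lb]. *)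
Lemma qbin_ub m j : 2 <= x ->
  qbin m j * (1 - x^-1 - x^-2 + x^-5) <= x ^+ (j * (m - j)).
Proof.
move=> x2; set kappa := 1 - _ - _ + _.
have [le_jm|lt_mj] := leqP j m; last first.
  by rewrite qbin_small // mul0r exprn_ge0 ?ltW.
have [a -> {m le_jm}] : exists a, m = (j + a)%N by exists (m - j)%N; lia.
rewrite addKn qbinE.
have ub : qfact (j + a) <= qfact a * (x ^+ (j * a) * x ^+ 'C(j.+1, 2)).
  elim: j => [|i IHi]; first by rewrite !expr0 !mulr1.
  have -> : qfact a * (x ^+ (i.+1 * a) * x ^+ 'C(i.+2, 2)) =
      qfact a * (x ^+ (i * a) * x ^+ 'C(i.+1, 2)) * x ^+ (i + a).+1.
    by rewrite [in LHS]binS bin1 -addSn mulSn !exprD; ring.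
  rewrite addSn qfactS.
  apply: ler_pM => //; rewrite ?(ltW (qfact_gt0 _)) ?(ltW (expr_sub1_gt0 _)) //.
  by rewrite lerBlDr lerDl.
rewrite mulrAC ler_pdivrMr ?mulr_gt0 ?qfact_gt0 //.
have lb := qfact_lb j x2; rewrite -/kappa in lb.
have := ler_wpM2l (ltW (qfact_gt0 a)) (ler_wpM2l (ltW (exprn_gt0 (j * a) x_gt0)) lb).
have [k0|k0] := leP 0 kappa; last first.
  move=> _; apply: (@le_trans _ _ 0).
    by rewrite mulr_ge0_le0 // ltW // qfact_gt0.
  by rewrite !mulr_ge0 ?exprn_ge0 // ltW // qfact_gt0.
move=> h; apply: le_trans (ler_wpM2r k0 ub) _.
rewrite -mulrA -mulrA; apply: le_trans h _.
by rewrite le_eqVlt; apply/orP; left; apply/eqP; ring.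
Qed.

(** Raising [d] by one multiplies the right side by [(x ^+ (a + d + D + 1) - 1) / (x ^+ (a + d + 1)
    - 1)], which is at least [x ^+ D]. *)
Lemma qbin_ratio a d D :
  x ^+ (d * D) * qbin (a + D) a <= qbin (a + d + D) (a + d).
Proof.
elim: d => [|d IHd]; first by rewrite !addn0 mul1r.
rewrite addnS addSn qbin_succ mulSn exprD -mulrA.
apply: ler_pM (IHd); first by rewrite exprn_ge0 // ltW.
  by rewrite mulr_ge0 ?qbin_ge0 ?exprn_ge0 // ltW.
rewrite ler_pdivlMr ?expr_sub1_gt0 // mulrBr mulr1 -exprD addnS addnC lerD2l.
by rewrite lerN2 exprn_ege1 // ltW.
Qed.

End QBinomial.

(** * Counting subspaces *)

Section SubspaceCounting.
Variables (F : finFieldType) (n : nat).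
Local Notation X := {vspace 'rV[F]_n}.
Local Notation q := (#|F|%:R : rat).

Lemma field_card_ge2 : 2 <= q.
Proof. by rewrite ler_nat; exact: finNzRing_gt1. Qed.

Lemma field_card_gt1 : 1 < q.
Proof. by rewrite ltr1n; exact: finNzRing_gt1. Qed.

Lemma card_memv (U : X) : #|[set v | v \in U]| = (#|F| ^ \dim U)%N.
Proof. by rewrite cardsE card_vspace. Qed.

Definition between (Z S A : X) b : {set X} :=
  [set B | [&& (Z <= B)%VS, (B <= A)%VS, \dim B == b & (B :&: S == 0)%VS]].

Lemma dim_add_line (Z : X) v : v \notin Z -> \dim (Z + <[v]>) = (\dim Z).+1.
Proof.
move=> vZ; have v0 : v != 0 by apply: contraNneq vZ => ->; exact: mem0v.
rewrite dimv_disjoint_sum ?dim_vline ?v0 ?addn1 //.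
apply/eqP; rewrite -subv0; apply/subvP => w; rewrite memv_cap => /andP[wZ].
case/vlineP=> a wE; move: wZ; rewrite wE rpredZeq (negbTE vZ) orbF.
by move=> /eqP->; rewrite scale0r mem0v.
Qed.

Lemma capv_add_line (Z S : X) v : (Z :&: S)%VS = 0%VS -> v \notin (Z + S)%VS ->
  ((Z + <[v]>) :&: S)%VS = 0%VS.
Proof.
move=> ZS vZS; apply/eqP; rewrite -subv0; apply/subvP => w.
rewrite memv_cap => /andP[/memv_addP[z zZ [_ /vlineP[a ->] wE]] wS].
have : a *: v \in (Z + S)%VS.
  have -> : a *: v = - z + w by rewrite wE addKr.
  by apply: memv_add; rewrite ?rpredN.
rewrite rpredZeq (negbTE vZS) orbF => /eqP a0.
by rewrite -ZS memv_cap wS wE a0 scale0r addr0 zZ.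
Qed.

(** Induction on [r], counting in two ways the pairs of a space [B] and a vector [v] of [B] outside
    [Z]. Since [B] avoids [S], such a [v] is automatically outside [Z + S], and [Z + <[v]>] takes
    the place of [Z]. *)
Lemma card_between (Z S A : X) r :
  (Z <= A)%VS -> (S <= A)%VS -> (Z :&: S)%VS = 0%VS ->
  #|between Z S A (\dim Z + r)%N|%:R =
    q ^+ (\dim S * r) * qbin q (\dim A - \dim Z - \dim S) r.
Proof.
elim: r Z => [|r IHr] Z ZA SA ZS.
  rewrite addn0 muln0 qbin0 ?mulr1 ?field_card_gt1 //.
  suff -> : between Z S A (\dim Z) = [set Z] by rewrite cards1.
  apply/setP => B; rewrite !inE; apply/idP/eqP => [|->].
    case/and4P => ZB _ dB _; apply/esym/eqP.
    by rewrite eqEdim ZB (eqP dB) leqnn.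
  by rewrite subvv ZA ZS !eqxx.
have dZS : \dim (Z + S) = (\dim Z + \dim S)%N by rewrite dimv_disjoint_sum.
have ZSA : (Z + S <= A)%VS by rewrite subv_add ZA.
have dle : (\dim Z + \dim S <= \dim A)%N by rewrite -dZS dimvS.
set N := between _ _ _ _.
pose V := [set v | v \in A] :\: [set v | v \in (Z + S)%VS].
have cV : #|V|%:R = q ^+ \dim A - q ^+ (\dim Z + \dim S).
  rewrite cardsD (setIidPr _); last first.
    by apply/subsetP => v; rewrite !inE; apply: subvP.
  rewrite !card_memv dZS natrB ?natrX //.
  by rewrite leq_exp2l // finNzRing_gt1.
have dbl : (\sum_(B in N) #|[set v | v \in B] :\: [set v | v \in Z]| =
    \sum_(v in V) #|between (Z + <[v]>) S A (\dim (Z + <[v]>)%VS + r)%N|)%N.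
  under eq_bigr => B _ do rewrite -sum1_card.
  under [RHS]eq_bigr => v _ do rewrite -sum1_card.
  rewrite (exchange_big_dep (mem V)) /=; last first.
    move=> B v; rewrite !inE => /and4P[ZB BA _ /eqP BS] /andP[vZ vB].
    rewrite (subvP BA _ vB) andbT; apply: contra vZ.
    case/memv_addP=> z zZ [s sS vE]; rewrite vE rpredDl //.
    suff -> : s = 0 by rewrite mem0v.
    apply/eqP; rewrite -memv0 -BS memv_cap sS andbT.
    have -> : s = - z + v by rewrite vE addKr.
    by rewrite rpredD ?rpredN // (subvP ZB).
  apply: eq_bigr => v; rewrite !inE => /andP[vZS vA]; apply: eq_bigl => B.
  have vZ : v \notin Z by apply: contra vZS; apply: subvP; exact: addvSl.
  rewrite !inE dim_add_line // subv_add -memvE vZ addSnnS /=.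
  by case: (Z <= B)%VS; case: (v \in B); rewrite ?andbF ?andbT.
have L : (\sum_(B in N) #|[set v | v \in B] :\: [set v | v \in Z]|)%:R =
    #|N|%:R * (q ^+ (\dim Z + r.+1) - q ^+ \dim Z).
  rewrite natr_sum (eq_bigr (fun=> q ^+ (\dim Z + r.+1) - q ^+ \dim Z)).
    by rewrite sumr_const mulr_natl.
  move=> B; rewrite inE => /and4P[ZB _ /eqP dB _].
  rewrite cardsD (setIidPr _); last first.
    by apply/subsetP => v; rewrite !inE; apply: subvP.
  rewrite !card_memv dB natrB ?natrX //.
  by rewrite leq_exp2l ?leq_addr // finNzRing_gt1.
have R : (\sum_(v in V) #|between (Z + <[v]>) S A (\dim (Z + <[v]>)%VS + r)%N|)%:R =
    (q ^+ \dim A - q ^+ (\dim Z + \dim S)) *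
    (q ^+ (\dim S * r) * qbin q (\dim A - \dim Z - \dim S).-1 r).
  rewrite natr_sum -cV mulr_natl -sumr_const; apply: eq_bigr => v.
  rewrite !inE => /andP[vZS vA].
  have vZ : v \notin Z by apply: contra vZS; apply: subvP; exact: addvSl.
  rewrite IHr ?capv_add_line ?subv_add ?ZA -?memvE //.
  by rewrite dim_add_line //; congr (_ * qbin _ _ _); lia.
have E : #|N|%:R * (q ^+ (\dim Z + r.+1) - q ^+ \dim Z) =
    (q ^+ \dim A - q ^+ (\dim Z + \dim S)) *
    (q ^+ (\dim S * r) * qbin q (\dim A - \dim Z - \dim S).-1 r).
  by rewrite -L dbl R.
have z0 l : q ^+ l != 0 by rewrite expf_neq0 // gt_eqF // (lt_trans _ field_card_gt1).
have nz : q ^+ (\dim Z + r.+1) - q ^+ \dim Z != 0.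
  rewrite exprD -[X in _ - X]mulr1 -mulrBr mulf_neq0 //.
  exact: expr_sub1_neq0 field_card_gt1 _.
apply: (mulIf nz); rewrite E.
have [m Em] : exists m, \dim A = (\dim Z + \dim S + m)%N.
  by exists (\dim A - (\dim Z + \dim S))%N; rewrite subnKC.
have -> : (\dim A - \dim Z - \dim S = m)%N by lia.
rewrite Em; case: m {Em} => [|m] /=.
  by rewrite addn0 subrr mul0r qbin_small // mulr0 mul0r.
rewrite qbin_succ ?field_card_gt1 // mulnS !exprD.
have := expr_sub1_neq0 field_card_gt1 r; move: (q ^+ r.+1) => u nu.
by field.
Qed.

End SubspaceCounting.

Lemma sum_indicator (R : pzRingType) (T : finType) (P b : pred T) :
  \sum_(a | P a) (b a)%:R = #|[set a | b a && P a]|%:R :> R.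
Proof.
rewrite -sum1_card natr_sum [RHS](eq_bigl (fun a => P a && b a)).
  by rewrite [RHS]big_mkcondr; apply: eq_bigr => a _; case: (b a).
by move=> a; rewrite inE andbC.
Qed.

(** * Harmonic functions on subspaces *)

Section Harmonic.
Variables (F : finFieldType) (n : nat).
Local Notation X := {vspace 'rV[F]_n}.
Local Notation q := (#|F|%:R : rat).
Let q_gt1 : 1 < q := field_card_gt1 F.

Definition subsum e (g : X -> rat) (a : X) : rat :=
  \sum_(E : X | (\dim E == e) && (E <= a)%VS) g E.

(** This is the q-analogue of Delsarte's harmonic functions; [subsum] lifts them from [e]-spaces to
    functions on larger spaces. *)
Definition harmonic e (g : X -> rat) := forall D : X, (\dim D < e)%N ->
  \sum_(E : X | (\dim E == e) && (D <= E)%VS) g E = 0.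

Lemma card_interval (Z A : X) r : (Z <= A)%VS ->
  #|[set B : X | [&& (Z <= B)%VS, (B <= A)%VS & \dim B == (\dim Z + r)%N]]|%:R =
  qbin q (\dim A - \dim Z) r.
Proof.
move=> ZA; have := @card_between F n Z 0%VS A r ZA (sub0v _) (capv0 _).
rewrite dimv0 mul0n mul1r subn0 => <-; congr (_%:R); apply: eq_card => B.
by rewrite !inE capv0 eqxx andbT.
Qed.

Lemma card_above (U : X) k :
  #|[set a : X | (U <= a)%VS && (\dim a == k)]|%:R =
  if (\dim U <= k)%N then qbin q (n - \dim U) (k - \dim U) else 0.
Proof.
case: leqP => [Uk|kU].
  have := card_interval (k - \dim U) (subvf U).
  rewrite dimvf /dim /= mul1n => <-; congr (_%:R); apply: eq_card => B.
  by rewrite !inE subvf subnKC.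
rewrite (_ : [set a : X | _] = set0) ?cards0 //; apply/setP => a; rewrite !inE.
by apply/negbTE/negP => /andP[/dimvS Ua /eqP ak]; lia.
Qed.

(** The summand is the Moebius function of the subspace lattice. Grouping the [B] by codimension in
    [A] gives [qbin_alternating_sum]. *)
Lemma moebius_interval (Z A : X) : (Z <= A)%VS -> (\dim Z < \dim A)%N ->
  \sum_(B : X | (Z <= B)%VS && (B <= A)%VS)
     (-1) ^+ (\dim A - \dim B) * q ^+ 'C(\dim A - \dim B, 2) = 0.
Proof.
move=> ZA ltZA.
have [m Em] : exists m, \dim A = (\dim Z + m.+1)%N.
  by exists (\dim A - (\dim Z).+1)%N; lia.
pose w (i : nat) : rat := (-1) ^+ i * q ^+ 'C(i, 2).
have dimB B : (Z <= B)%VS && (B <= A)%VS -> (\dim B - \dim Z < m.+2)%N.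
  by case/andP=> /dimvS ? /dimvS ?; lia.
rewrite (partition_big (fun B : X => inord (\dim B - \dim Z) : 'I_m.+2) xpredT) //=.
rewrite (reindex_inj rev_ord_inj) /= -[RHS](qbin_alternating_sum q_gt1 m).
apply: eq_bigr => l _; have ltl := ltn_ord l.
transitivity (\sum_(B in [set B : X | [&& (Z <= B)%VS, (B <= A)%VS &
    \dim B == (\dim Z + (m.+1 - l))%N]]) w l).
  apply: eq_big => [B|B].
    rewrite inE andbA; case: (boolP ((Z <= B)%VS && (B <= A)%VS)) => //= ZBA.
    rewrite -(inj_eq val_inj) /= inordK ?dimB //.
    by case/andP: ZBA => /dimvS ? /dimvS ?; apply/eqP/eqP; lia.
  case/andP=> ZBA /eqP/(congr1 val); rewrite /= inordK ?dimB // => dB.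
  have -> : (\dim A - \dim B = l)%N by case/andP: ZBA => /dimvS ? /dimvS ?; lia.
  by [].
rewrite sumr_const -[_ *+ _]mulr_natr card_interval // Em addKn.
congr (_ * _); have := @qbin_sym _ q (m.+1 - l) l; rewrite subnK //; lia.
Qed.

(** Induction on [e - \dim S]. Harmonicity at [S], split according to [S' = E :&: J], expresses the
    sum for [S] by those for larger [S']; [moebius_interval] on each [[S, E]] collects their
    coefficients. *)
Lemma sum_meet_eq e g (J S : X) : harmonic e g -> (S <= J)%VS -> (\dim S <= e)%N ->
  \sum_(E : X | (\dim E == e) && ((E :&: J)%VS == S)) g E =
  (-1) ^+ (e - \dim S) * q ^+ 'C(e - \dim S, 2) *
    \sum_(E : X | [&& \dim E == e, (S <= E)%VS & (E <= J)%VS]) g E.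
Proof.
move=> harm_g; have [r] := ubnP (e - \dim S)%N; elim: r => // r IHr in S *.
move=> ltr SJ; rewrite leq_eqVlt => /predU1P[dS|ltSe].
  rewrite dS subnn bin_small // !expr0 !mul1r; apply: eq_bigl => E.
  case: eqP => //= dE; apply/eqP/andP => [ES|[SE _]].
    have <- : (E :&: J)%VS = E.
      by apply/eqP; rewrite eqEdim capvSl ES dS dE leqnn.
    by rewrite ES subvv SJ.
  have -> : E = S by apply/esym/eqP; rewrite eqEdim SE dE dS leqnn.
  exact/capv_idPl.
have := harm_g S ltSe.
rewrite (partition_big (fun E : X => (E :&: J)%VS)
  (fun S' : X => (S <= S')%VS && (S' <= J)%VS)) /=; last first.
  by move=> E /andP[_ SE]; rewrite subv_cap SE SJ capvSr.
rewrite (bigD1 S) /=; last by rewrite subvv SJ.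
move/eqP; rewrite addr_eq0 => /eqP H.
rewrite (eq_bigl (fun E => (\dim E == e) && (S <= E)%VS && ((E :&: J)%VS == S)));
  last first.
  move=> E; case: (boolP ((E :&: J)%VS == S)) => [/eqP ES|]; rewrite ?andbF //.
  by rewrite -ES capvSl !andbT.
rewrite H.
pose w (i : nat) : rat := (-1) ^+ i * q ^+ 'C(i, 2).
rewrite (eq_bigr (fun S' : X => \sum_(E : X | [&& \dim E == e, (S' <= E)%VS &
    (E <= J)%VS]) w (e - \dim S')%N * g E)); last first.
  move=> S' /andP[/andP[SS' S'J] S'S].
  have ltd : (\dim S < \dim S')%N.
    rewrite ltn_neqAle dimvS // andbT; apply: contra S'S => /eqP d.
    by rewrite eq_sym eqEdim SS' d leqnn.
  have [leS'e|lteS'] := leqP (\dim S') e; last first.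
    transitivity (0 : rat); [apply: big_pred0 | apply/esym/big_pred0] => E.
      apply/negbTE/negP => /andP[/andP[/eqP dE _] /eqP ES'].
      by have := dimvS (capvSl E J); rewrite ES'; lia.
    apply/negbTE/negP => /and3P[/eqP dE S'E _].
    by have := dimvS S'E; lia.
  rewrite -mulr_sumr -IHr //; last lia.
  apply: eq_bigl => E; case: (boolP ((E :&: J)%VS == S')) => [/eqP ES|];
    rewrite ?andbF // !andbT.
  by rewrite (subv_trans SS') ?andbT // -ES capvSl.
rewrite (exchange_big_dep (fun E : X => [&& \dim E == e, (S <= E)%VS & (E <= J)%VS]))
  /=; last first.
  move=> S' E /andP[/andP[SS' _] _] /and3P[-> S'E ->]; rewrite andbT /=.
  exact: subv_trans S'E.
rewrite mulr_sumr -sumrN; apply: eq_bigr => E /and3P[/eqP dE SE EJ].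
rewrite -mulr_suml -mulNr; congr (_ * _).
have := @moebius_interval S E SE; rewrite dE => /(_ ltSe).
rewrite (bigD1 S) ?subvv //= => /eqP; rewrite addr_eq0 => /eqP->.
congr (- _); apply: eq_bigl => S'.
case: (boolP (S' <= E)%VS) => S'E; rewrite ?andbF ?andbT ?dE ?eqxx ?EJ //=.
by rewrite (subv_trans S'E EJ) !andbT.
Qed.

Lemma sum_disjoint e g (J : X) : harmonic e g ->
  \sum_(E : X | (\dim E == e) && ((E :&: J)%VS == 0%VS)) g E =
  (-1) ^+ e * q ^+ 'C(e, 2) * subsum e g J.
Proof.
move=> harm_g; rewrite (sum_meet_eq harm_g) ?sub0v ?dimv0 // subn0.
by congr (_ * _); apply: eq_bigl => E; rewrite sub0v.
Qed.

(** For each value of [E :&: D], [sum_meet_eq] gives a sum over the [e]-spaces inside [D], and there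
    are none. *)
Lemma harmonic_meet e g (D : X) (N : nat -> rat) : harmonic e g ->
  (\dim D < e)%N ->
  \sum_(E : X | \dim E == e) g E * N (\dim (E :&: D)%VS) = 0.
Proof.
move=> harm_g ltDe.
rewrite (partition_big (fun E : X => (E :&: D)%VS) (fun S => (S <= D)%VS)) /=;
  last by move=> E _; exact: capvSr.
apply: big1 => S SD.
rewrite (eq_bigr (fun E => g E * N (\dim S))); last by move=> E /andP[_ /eqP->].
rewrite -mulr_suml (sum_meet_eq harm_g) //; last by have := dimvS SD; lia.
rewrite [X in _ * X * N _]big_pred0 ?mulr0 ?mul0r // => E.
apply/negbTE/negP => /and3P[/eqP dE _ /dimvS]; lia.
Qed.

(** The product [g E * h D] is counted once for each [k]-space above [E + D], a number that depends
    only on [\dim (E :&: D)], so [harmonic_meet] applies. *)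
Lemma subsum_orthogonal k d e g h : harmonic e g -> (d < e)%N ->
  \sum_(a : X | \dim a == k) subsum e g a * subsum d h a = 0.
Proof.
move=> harm_g lt_de.
transitivity (\sum_(D : X | \dim D == d) h D *
   \sum_(E : X | \dim E == e) g E *
     #|[set a : X | (E + D <= a)%VS && (\dim a == k)]|%:R).
  transitivity (\sum_(a : X | \dim a == k) \sum_(D : X | \dim D == d)
    \sum_(E : X | \dim E == e) (E + D <= a)%VS%:R * (h D * g E)).
    apply: eq_bigr => a _; rewrite mulrC /subsum mulr_suml.
    rewrite [LHS]big_mkcondr; apply: eq_bigr => D _.
    rewrite mulr_sumr big_mkcondr /=.
    case: (boolP (D <= a)%VS) => Da.
      apply: eq_bigr => E _; rewrite subv_add Da andbT.
      by case: ifP; rewrite ?mul1r ?mul0r.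
    by rewrite big1 // => E _; rewrite subv_add (negbTE Da) andbF mul0r.
  rewrite exchange_big /=; apply: eq_bigr => D _; rewrite mulr_sumr exchange_big /=.
  apply: eq_bigr => E _.
  by rewrite -mulr_suml mulrC -mulrA sum_indicator.
apply: big1 => D /eqP dD.
pose N s := if (e + d - s <= k)%N
  then qbin q (n - (e + d - s)) (k - (e + d - s)) else 0.
rewrite (eq_bigr (fun E : X => g E * N (\dim (E :&: D)%VS))).
  by rewrite harmonic_meet ?mulr0 ?dD.
move=> E /eqP dE; rewrite card_above /N.
by have := dimv_sum_cap E D; rewrite dE dD => <-; rewrite addnK.
Qed.

(** For fixed [J] and [E], the spaces [b] above [E] and disjoint from [J] number [c] if [E] and [J]
    are disjoint, and 0 otherwise. Then [sum_disjoint] turns the [E] disjoint from [J] into those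
    inside [J], and the [J] between [E] and [a] are counted. *)
Lemma disjoint_count_eigen k j e g (a : X) :
  harmonic e g -> (e <= k)%N -> \dim a = k ->
  \sum_(b : X | \dim b == k)
     #|[set J : X | [&& \dim J == j, (J <= a)%VS & (J :&: b == 0)%VS]]|%:R *
     subsum e g b =
  (-1) ^+ e * q ^+ 'C(e, 2) * (q ^+ (j * (k - e)) * qbin q (n - e - j) (k - e)) *
    (if (e <= j)%N then qbin q (k - e) (j - e) else 0) * subsum e g a.
Proof.
move=> harm_g le_ek dak.
pose c : rat := q ^+ (j * (k - e)) * qbin q (n - e - j) (k - e).
transitivity (\sum_(J : X | (\dim J == j) && (J <= a)%VS)
   \sum_(E : X | (\dim E == e) && ((E :&: J)%VS == 0%VS)) c * g E).
  transitivity (\sum_(b : X | \dim b == k)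
     \sum_(J : X | (\dim J == j) && (J <= a)%VS)
     \sum_(E : X | \dim E == e) ((J :&: b == 0)%VS && (E <= b)%VS)%:R * g E).
    apply: eq_bigr => b _.
    under [RHS]eq_bigr => J _.
      rewrite (_ : \sum_(E : X | \dim E == e) _ =
        (J :&: b == 0)%VS%:R * subsum e g b); first over.
      rewrite /subsum [X in _ * X]big_mkcondr mulr_sumr; apply: eq_bigr => E _.
      by case: (_ == _); case: (_ <= _)%VS; rewrite ?mulr0 ?mul0r ?mul1r.
    rewrite -mulr_suml sum_indicator; congr (_%:R * _); apply: eq_card => J.
    by rewrite !inE; case: (_ == j); rewrite ?andbF ?andbT //= andbC.
  rewrite exchange_big /=; apply: eq_bigr => J /andP[/eqP dJ _].
  rewrite exchange_big big_mkcondr /=; apply: eq_bigr => E /eqP dE.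
  rewrite -mulr_suml sum_indicator; case: ifP => [EJ|EJ].
    congr (_ * _).
    have := @card_between F n E J fullv (k - e) (subvf _) (subvf _) (eqP EJ).
    rewrite dE dJ dimvf /dim /= mul1n -/c => <-; congr (_%:R).
    apply: eq_card => b; rewrite !inE subvf subnKC //= capvC.
    by rewrite andbAC [RHS]andbCA -andbA andbC andbA.
  rewrite (_ : [set b : X | _] = set0) ?cards0 ?mul0r //.
  apply/setP => b; rewrite !inE; apply/negbTE/negP => /andP[/andP[/eqP Jb Eb] _].
  by move: EJ; rewrite -subv0 -Jb subv_cap capvSr (subv_trans (capvSl _ _)).
under eq_bigr => J _ do rewrite -mulr_sumr (sum_disjoint _ harm_g).
rewrite -!mulr_sumr -/c.
rewrite (_ : \sum_(J : X | _) _ = (if (e <= j)%N then qbin q (k - e) (j - e) else 0)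
   * subsum e g a); first by ring.
rewrite /subsum (exchange_big_dep (fun E : X => (\dim E == e) && (E <= a)%VS)) /=;
  last by move=> J E /andP[_ Ja] /andP[-> EJ]; exact: subv_trans Ja.
rewrite mulr_sumr; apply: eq_bigr => E /andP[/eqP dE Ea].
rewrite sumr_const -[_ *+ _]mulr_natl; congr (_ * _).
case: leqP => [le_ej|lt_je].
  have := card_interval (j - e) Ea; rewrite dE dak subnKC // => <-; congr (_%:R).
  apply: eq_card => J; rewrite !inE unfold_in /= eqxx.
  by case: (_ == j); case: (_ <= a)%VS; case: (E <= _)%VS.
rewrite eq_card0 // => J; rewrite !inE unfold_in /=.
by apply/negbTE/negP => /andP[/andP[/eqP dJ _] /andP[_ /dimvS]]; lia.
Qed.

End Harmonic.

(** * The Erdos-Ko-Rado theorem for subspaces *)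

Section FranklWilsonWeights.
Variables (K : realFieldType) (x : K).
Hypothesis x_ge2 : 2 <= x.

Let x_gt1 : 1 < x. Proof. by apply: lt_le_trans x_ge2; rewrite ltr1n. Qed.
Let x_gt0 : 0 < x. Proof. exact: lt_trans x_gt1. Qed.
Let x_neq0 : x != 0. Proof. exact: lt0r_neq0. Qed.

(* Here [t = T + 1] and [k = T + 1 + m]. *)
Definition fw_weight T m i : K := (-1) ^+ (T - i) *
  x ^- ('C(T.+1 - i, 2) + i * (T.+1 + m - i) + (T - i) * m) *
  qbin x (T + m - i) (T - i).

(** The terms with [i < s] vanish, and the shift [i = s + j] turns the rest into
    [qbin_frankl_wilson]. Here [s] stands for the dimension in which a [t]-space meets a
    [k]-space. *)
Lemma sum_fw_weight T m s : (s <= T)%N ->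
  \sum_(i < T.+1) fw_weight T m i *
    (x ^+ (s * (T.+1 + m - i)) * qbin x (T.+1 + m - s) (T.+1 + m - i)) = 1.
Proof.
move=> sT; have [N ->] : exists N, T = (s + N)%N by exists (T - s)%N; lia.
rewrite -addnS big_split_ord /= big1 ?add0r => [|i _]; last first.
  have ltis := ltn_ord i; rewrite qbin_small ?mulr0 //; lia.
rewrite -[RHS](qbin_frankl_wilson x_gt1 N m); apply: eq_bigr => j _.
have ltj := ltn_ord j; move: (nat_of_ord j) ltj => {}j ltj.
have [u Eu] : exists u, N = (j + u)%N by exists (N - j)%N; lia.
rewrite /fw_weight Eu.
have -> : (s + (j + u) - (s + j) = u)%N by lia.
have -> : ((s + (j + u)).+1 - (s + j) = u.+1)%N by lia.
have -> : ((j + u).+1 - j = u.+1)%N by lia.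
have -> : ((s + (j + u)).+1 + m - (s + j) = u.+1 + m)%N by lia.
have -> : (s + (j + u) + m - (s + j) = u + m)%N by lia.
have -> : (s + (j + u).+1 + m - s = j + (u.+1 + m))%N by lia.
have -> : (s + (j + u).+1 + m - (s + j) = u.+1 + m)%N by lia.
have -> : ((j + u).+1 + m = j + (u.+1 + m))%N by lia.
have -> : (j + u + m - j = u + m)%N by lia.
rewrite !addKn -qbin_sym.
have -> : ('C(u.+1, 2) + (s + j) * (u.+1 + m) + u * m =
   'C(u.+1, 2) + j * (u.+1 + m) + u * m + s * (u.+1 + m))%N by lia.
rewrite [x ^+ (_ + s * _)]exprD invfM.
have nz : x ^+ (s * (u.+1 + m)) != 0 by rewrite expf_neq0.
move: (x ^+ (s * _)) nz => y nz; move: ((x ^+ _)^-1) => z.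
by move: ((-1) ^+ u) (qbin _ _ j) (qbin _ _ u) => a b c; field.
Qed.

(** The constant of [qbin_ub] is smallest at [x = 2], where it is [3/4 * 3/8 = 9/32]. *)
Lemma qbin_le_const m j : qbin x m j <= 32 / 9 * x ^+ (j * (m - j)).
Proof.
have := qbin_ub x_gt1 m j x_ge2; have := qbin_ge0 x_gt1 m j.
have -> : 1 - x^-1 - x^-2 + x^-5 = 1 - x^-1 - x^-1 ^+ 2 + x^-1 ^+ 5.
  by rewrite !exprVn.
have y0 : 0 < x^-1 by rewrite invr_gt0.
have y2 : x^-1 <= 1 / 2 by rewrite mul1r lef_pV2 ?posrE.
move: (x^-1) y0 y2 => y y0 y2.
suff : 9 / 32 <= 1 - y - y ^+ 2 + y ^+ 5.
  by move: (qbin _ _ _) (x ^+ _) (1 - _ - _ + _) => a b c h1 h2 h3; nra.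
have -> : 1 - y - y ^+ 2 + y ^+ 5 = (1 - y ^+ 2) * (1 - y - y ^+ 3) by ring.
have h2 : y ^+ 2 <= 1 / 4 by nra.
have h3 : y ^+ 3 <= 1 / 8 by rewrite exprS; nra.
move: (y ^+ 2) (y ^+ 3) h2 h3 => a b h2 h3; nra.
Qed.

Lemma fw_exponent (i u d p r m : nat) : m = (d + i + p)%N ->
  (u * m + p * i + 'C((i + u).+1 + d, 2) + (u.+1 + m) * (i + p) +
     ('C(d.+1, 2) + 'C(i.+1, 2) + 2 * i * d) + d * (p + r) =
   'C(u.+1, 2) + i * (u.+1 + m) + u * m + (u.+1 + m) * m + d * (r + i))%N.
Proof.
move=> ->; have sq l : ('C(l, 2) + 'C(l, 2) + l = l * l)%N.
  by elim: l => // l IHl; rewrite binS bin1; lia.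
have -> : ((i + u).+1 + d = i + u.+1 + d)%N by lia.
by have := sq i; have := sq d; rewrite !bin2D !binS !bin1; lia.
Qed.

(** This is the absolute value of one term of the eigenvalue, in the coordinates [T = i + u],
    [m = d + i + p], [n = 2 * k + r]. The quotient of the two binomials involving [r] is controlled
    by [qbin_ratio]; the other two cost [32 / 9] each, except that for [i = 0] the last one is 1. *)
Lemma fw_term_le (i u d p r m : nat) : m = (d + i + p)%N ->
  x ^- ('C(u.+1, 2) + i * (u.+1 + m) + u * m) * qbin x (u + m) u /
    (x ^+ ((u.+1 + m) * m) * qbin x (m + (r + i)) m) *
  (x ^+ 'C((i + u).+1 + d, 2) *
    (x ^+ ((u.+1 + m) * (i + p)) * qbin x (i + p + (r + i)) (i + p)) *
    qbin x (i + p) p) <=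
  (if i == 0%N then 32 / 9 else (32 / 9) ^+ 2) *
    x ^- ('C(d.+1, 2) + 'C(i.+1, 2) + 2 * i * d).
Proof.
move=> Em.
have c0 : 0 <= 32 / 9 :> K by lra.
pose A : K := qbin x (u + m) u; pose B : K := qbin x (i + p) p.
pose C : K := qbin x (i + p + (r + i)) (i + p); pose D : K := qbin x (m + (r + i)) m.
have hA : A <= 32 / 9 * x ^+ (u * m).
  by have := qbin_le_const (u + m) u; rewrite addKn.
have hB : B <= (if i == 0%N then 1 else 32 / 9) * x ^+ (p * i).
  have := qbin_le_const (i + p) p; rewrite addnK; case: eqP => // i0 _.
  by rewrite /B i0 add0n qbinnn // muln0 mul1r.
have D0 : 0 < D by apply: qbin_gt0 => //; apply: leq_addr.
have hC : x ^+ (d * (r + i)) * C <= D.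
  have := qbin_ratio x_gt1 (i + p) d (r + i); rewrite /C /D Em.
  by have -> : (i + p + d = d + i + p)%N by lia.
have A0 : 0 <= A by exact: qbin_ge0.
have B0 : 0 <= B by exact: qbin_ge0.
have C0 : 0 <= C by exact: qbin_ge0.
have P (l : nat) : 0 < x ^+ l by rewrite exprn_gt0.
have -> : (if i == 0%N then 32 / 9 else (32 / 9) ^+ 2) =
   32 / 9 * (if i == 0%N then 1 else 32 / 9) :> K.
  by case: ifP; rewrite ?mulr1 ?expr2.
set c' : K := if i == 0%N then 1 else 32 / 9 in hB *.
have c'0 : 0 <= c' by rewrite /c'; case: ifP.
set e1 := ('C(u.+1, 2) + _ + _)%N; set e2 := ((u.+1 + m) * m)%N.
set e3 := 'C(_, 2); set e4 := (_ * (i + p))%N; set e5 := ('C(_, 2) + _ + _)%N.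
rewrite -/A -/B -/C -/D.
have expo : (u * m + p * i + e3 + e4 + e5 + d * (p + r) = e1 + e2 + d * (r + i))%N.
  by rewrite /e1 /e2 /e3 /e4 /e5; exact: fw_exponent.
clearbody e1 e2 e3 e4 e5.
have -> : x ^- e1 * A / (x ^+ e2 * D) * (x ^+ e3 * (x ^+ e4 * C) * B) =
    A * B * (C * x ^+ (e3 + e4)) / (x ^+ (e1 + e2) * D).
  rewrite !exprD; have := lt0r_neq0 D0; have := lt0r_neq0 (P e1).
  by have := lt0r_neq0 (P e2); move=> *; field; apply/and3P.
rewrite ler_pdivrMr ?mulr_gt0 // [leRHS]mulrAC ler_pdivlMr //.
apply: le_trans (_ : 32 / 9 * x ^+ (u * m) * (c' * x ^+ (p * i)) *
    (C * x ^+ (e3 + e4)) * x ^+ e5 <= _).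
  rewrite ler_wpM2r ?(ltW (P _)) // ler_wpM2r ?mulr_ge0 ?(ltW (P _)) //.
  exact: ler_pM.
have -> : 32 / 9 * x ^+ (u * m) * (c' * x ^+ (p * i)) * (C * x ^+ (e3 + e4)) *
    x ^+ e5 = 32 / 9 * c' * (C * x ^+ (u * m + p * i + e3 + e4 + e5)).
  by rewrite !exprD; ring.
apply: ler_wpM2l; first by rewrite mulr_ge0.
apply: (@le_trans _ _ (C * x ^+ (e1 + e2 + d * (r + i)))).
  by rewrite ler_wpM2l // ler_eXn2l // -expo leq_addr.
have := ler_wpM2l (ltW (P (e1 + e2)%N)) hC; apply: le_trans.
by rewrite le_eqVlt exprD; apply/orP; left; apply/eqP; ring.
Qed.

(** The excluded [i] is the dominant term: 1 for [d = 1], and 0 otherwise. The remaining terms are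
    then dominated by a geometric series. *)
Lemma fw_exponent_ge i d : (0 < d)%N -> ~~ odd (d + i) -> i != (d == 1)%N ->
  (7 + i <= 'C(d.+1, 2) + 'C(i.+1, 2) + 2 * i * d)%N.
Proof.
have sq l : ('C(l, 2) + 'C(l, 2) + l = l * l)%N.
  by elim: l => // l IHl; rewrite binS bin1; lia.
case: d => [//|[|d]] _.
  by case: i => [|[|[|i]]] //= _ _; have := sq i.+4; nia.
by case: i => [//|i] _ _; have := sq d.+3; have := sq i.+2; nia.
Qed.

Lemma sum_half_pow N : \sum_(i < N) (2^-1 : K) ^+ (7 + i) <= 2^-1 ^+ 6.
Proof.
suff -> : \sum_(i < N) (2^-1 : K) ^+ (7 + i) = 2^-1 ^+ 6 - 2^-1 ^+ (6 + N).
  by rewrite gerBl exprn_ge0 // invr_ge0.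
elim: N => [|N IHN]; first by rewrite big_ord0 addn0 subrr.
rewrite big_ord_recr /= IHN [(6 + N.+1)%N]addnS [(7 + N)%N]addSn !exprS; lra.
Qed.

(* [1 +] the eigenvalue of the Frankl-Wilson matrix on harmonic functions of
   degree [e = T + 1 + d]. *)
Lemma fw_eigenvalue_ge0 T m n d k e : (0 < d <= m)%N ->
  k = (T.+1 + m)%N -> e = (T.+1 + d)%N -> (2 * k <= n)%N ->
  0 <= 1 + \sum_(i < T.+1)
    fw_weight T m i / (x ^+ ((k - i) * m) * qbin x (n - T.+1 - (k - i)) m) *
    ((-1) ^+ e * x ^+ 'C(e, 2) *
     (x ^+ ((k - i) * (k - e)) * qbin x (n - e - (k - i)) (k - e)) *
     (if (e <= k - i)%N then qbin x (k - e) (k - i - e) else 0)).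
Proof.
move=> /andP[d0 dm] Ek Ed kn.
(* The terms with [d + i] odd are nonnegative; [W i] bounds the others, the largest
   of which is at [i0]. *)
pose i0 := (d == 1)%N : nat.
pose W i : K := (if i == i0 then (32 / 9) ^+ 2 / 16 else 0) +
  (32 / 9) ^+ 2 * (2^-1) ^+ (7 + i).
have half0 : 0 < 2^-1 :> K by rewrite invr_gt0.
have Wc i : 0 <= (32 / 9) ^+ 2 * (2^-1) ^+ (7 + i) :> K.
  by rewrite mulr_ge0 ?exprn_ge0 ?(ltW half0) //; lra.
have W0 i : 0 <= W i.
  by rewrite /W addr_ge0 //; case: ifP => // _; lra.
have W_lb i : ~~ odd (d + i) ->
    (if i == 0%N then 32 / 9 else (32 / 9) ^+ 2) *
    x ^- ('C(d.+1, 2) + 'C(i.+1, 2) + 2 * i * d) <= W i.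
  move=> odd_di; set E := (_ + _ + _)%N.
  have xE l : (l <= E)%N -> x ^- E <= 2^-1 ^+ l.
    move=> lE; rewrite exprVn lef_pV2 ?posrE ?exprn_gt0 //.
    apply: le_trans (_ : x ^+ l <= _); last by rewrite ler_eXn2l.
    by rewrite lerXn2r ?nnegrE // ltW.
  have xE0 : 0 <= x ^- E by rewrite invr_ge0 exprn_ge0 // ltW.
  case: (eqVneq i i0) => [Ei|ni].
    apply: le_trans (_ : (32 / 9) ^+ 2 / 16 <= _); last first.
      by rewrite /W Ei eqxx lerDl.
    (* For [d = 1] the term at [i0 = 1] has exponent 4. Otherwise [i0 = 0], where a single factor
       [32 / 9] and an exponent of at least 3 give even less. *)
    have [d1|nd1] := eqVneq d 1%N.
      have := xE 4; rewrite /E Ei /i0 d1 /= => /(_ isT); move: (x ^- _) => y; lra.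
    have := xE 3; rewrite Ei /i0 (negbTE nd1) /= => h.
    have /h : (3 <= E)%N.
      have d2 : (1 < d)%N by rewrite ltn_neqAle eq_sym nd1.
      apply: leq_trans (leq_bin2l 2 (d2 : (2 < d.+1)%N)) _.
      by rewrite /E -addnA leq_addr.
    move: (x ^- _) => y; lra.
  rewrite /W (negbTE ni) add0r; apply: ler_pM => //.
  - by case: ifP => _; lra.
  - by case: ifP => _; lra.
  by apply: xE; exact: fw_exponent_ge.
rewrite -lerBlDl sub0r.
apply: le_trans (_ : \sum_(i < T.+1) - W i <= _); last first.
  apply: ler_sum => i _.
  have := leq_ord i; move: (nat_of_ord i) => {}i lei.
  case: ifP => [le_e|]; last by rewrite mulr0 mulr0 oppr_le0.
  have [u Tu] : exists u, T = (i + u)%N by exists (T - i)%N; lia.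
  have [p mp] : exists p, m = (d + i + p)%N by exists (m - d - i)%N; lia.
  have [r nr] : exists r, n = (2 * k + r)%N by exists (n - 2 * k)%N; lia.
  have := fw_term_le u r mp; set V := (X in X <= _) => leV.
  have V0 : 0 <= V.
    by rewrite /V !(mulr_ge0, invr_ge0, exprn_ge0, qbin_ge0) ?ltW.
  (* The weight has sign [(-1) ^+ u] and the harmonic factor [(-1) ^+ (i + u + 1 + d)], so [u] drops
     out of the product. *)
  rewrite (_ : fw_weight T m i / _ * _ = (-1) ^+ (d + i).+1 * V); last first.
    rewrite /fw_weight.
    have -> : (T.+1 - i = u.+1)%N by lia.
    have -> : (T.+1 + m - i = u.+1 + m)%N by lia.
    have -> : (T - i = u)%N by lia.
    have -> : (T + m - i = u + m)%N by lia.
    have -> : (k - i = u.+1 + m)%N by lia.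
    have -> : (n - T.+1 - (u.+1 + m) = m + (r + i))%N by lia.
    have -> : (n - e - (u.+1 + m) = i + p + (r + i))%N by lia.
    have -> : (k - e = i + p)%N by lia.
    have -> : (u.+1 + m - e = p)%N by lia.
    have Ee : e = ((i + u).+1 + d)%N by lia.
    have -> : (-1) ^+ e = (-1) ^+ u * (-1) ^+ (d + i).+1 :> K.
      by rewrite -exprD -signr_odd -[RHS]signr_odd; congr (_ ^+ nat_of_bool _); lia.
    rewrite Ee /V.
    have s1 : (-1) ^+ u * (-1) ^+ u = 1 :> K by rewrite -expr2 sqrr_sign.
    move: ((-1) ^+ u) ((-1) ^+ (d + i).+1) s1 => sg sg' sgsg.
    set y := (x ^+ ('C(u.+1, 2) + _ + _))^-1; set z := (x ^+ _ * _)^-1.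
    rewrite -[RHS]mul1r -sgsg; clearbody y z.
    move: (x ^+ (_ * (i + p))) (x ^+ _) (qbin _ _ u) (qbin _ _ p) (qbin _ _ (i + p)).
    by move=> *; ring.
  rewrite exprS -signr_odd.
  have := W_lb i; have := W0 i; case: (odd (d + i)) => /=.
    move=> Wi _; rewrite expr1 mulrNN !mul1r; apply: le_trans V0.
    by rewrite oppr_le0.
  move=> _ /(_ isT) leW; rewrite expr0 mulr1 mulN1r lerN2; exact: le_trans leW.
rewrite sumrN lerN2 big_split /=.
rewrite -mulr_sumr; have := sum_half_pow T.+1.
have : \sum_(i < T.+1) (if i == i0 :> nat then (32 / 9) ^+ 2 / 16 else 0) <=
    (32 / 9) ^+ 2 / 16 :> K.
  rewrite (bigID (fun i : 'I_T.+1 => i == i0 :> nat)) /=.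
  rewrite [X in _ + X]big1 ?addr0; last by move=> i /negbTE->.
  rewrite (eq_bigr (fun=> (32 / 9) ^+ 2 / 16)) => [|i ->//].
  rewrite sumr_const; case: (ltnP i0 T.+1) => lti.
    by rewrite (@eq_card1 _ (Ordinal lti)).
  rewrite eq_card0 => [|i]; first by rewrite mulr0n; lra.
  by apply/eqP => ii; have := ltn_ord i; rewrite ii ltnNge lti.
(* The total is [1024/81 * (1/16 + 1/64) = 80/81], just below 1. *)
have -> : (2^-1 : K) ^+ 6 = 1 / 64 by field.
have -> : (32 / 9 : K) ^+ 2 = 1024 / 81 by field.
move: (\sum_(i < _) _) (\sum_(i < _) _) => a b; lra.
Qed.

End FranklWilsonWeights.

(** * Orthogonal projection and decomposition into harmonic functions *)

Lemma sqr_mulmx_tr_eq0 (R : realFieldType) p (v : 'rV[R]_p) :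
  v *m v^T = 0 -> v = 0.
Proof.
move=> /matrixP/(_ 0 0); rewrite !mxE => sv.
apply/rowP => j; rewrite !mxE.
have := psumr_eq0P (fun i _ => sqr_ge0 (v 0 i)) _ => /(_ xpredT).
rewrite (eq_bigr (fun i => v 0 i * v^T i 0)); last by move=> i _; rewrite !mxE expr2.
by move=> /(_ sv j isT)/eqP; rewrite sqrf_eq0 => /eqP.
Qed.

(** The normal equations are solvable because [M *m M^T] and [M] have the same left kernel: if
    [u *m M *m M^T = 0], then the sum of the squares of the entries of [u *m M] is zero. *)
Lemma mx_orthogonal_decomposition (R : realFieldType) m p
    (M : 'M[R]_(m, p)) (v : 'rV_p) : exists u, (v - u *m M) *m M^T = 0.
Proof.
suff : (M^T <= M *m M^T)%MS.
  move=> /(submx_trans (submxMl v M^T))/submxP[u Eu]; exists u.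
  by rewrite mulmxBl Eu mulmxA subrr.
rewrite -(geq_leqif (mxrank_leqif_sup (submxMl M M^T))) mxrank_tr.
suff : (\rank (kermx (M *m M^T)) <= \rank (kermx M))%N.
  rewrite !mxrank_ker; have := rank_leq_row M; have := rank_leq_row (M *m M^T).
  by move: (\rank (M *m M^T)) (\rank M) => a b; lia.
apply/mxrankS/rV_subP => u /sub_kermxP uMM; apply/sub_kermxP.
by apply: sqr_mulmx_tr_eq0; rewrite trmx_mul -mulmxA [M *m _]mulmxA mulmxA uMM mul0mx.
Qed.

Lemma fun_orthogonal_decomposition (R : realFieldType) (I J : finType)
    (A : I -> J -> R) (v : J -> R) :
  exists u : I -> R, forall i,
    \sum_j A i j * (v j - \sum_i' u i' * A i' j) = 0.
Proof.
pose M : 'M[R]_(#|I|, #|J|) := \matrix_(i, j) A (enum_val i) (enum_val j).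
have [u uP] := mx_orthogonal_decomposition M (\row_j v (enum_val j)).
exists (fun i => u 0 (enum_rank i)) => i.
move/matrixP/(_ 0 (enum_rank i)): uP; rewrite !mxE => uP; rewrite -[RHS]uP.
rewrite (reindex (@enum_val J J)); last by apply: onW_bij; apply: enum_val_bij.
apply: eq_bigr => j _; rewrite !mxE enum_rankK mulrC; congr ((_ - _) * _).
rewrite (reindex (@enum_val I I)); last by apply: onW_bij; apply: enum_val_bij.
by apply: eq_bigr => i' _; rewrite !mxE enum_valK.
Qed.

Section HarmonicDecomposition.
Variables (F : finFieldType) (n k : nat).
Local Notation X := {vspace 'rV[F]_n}.
Local Notation q := (#|F|%:R : rat).

Definition harmonic_sum (f : X -> rat) := exists g : nat -> X -> rat,
  (forall e, harmonic e (g e)) /\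
  (forall a, \dim a = k -> f a = \sum_(e < k.+1) subsum e (g e) a).

Lemma harmonic_sumD f1 f2 :
  harmonic_sum f1 -> harmonic_sum f2 -> harmonic_sum (fun a => f1 a + f2 a).
Proof.
move=> [g1 [h1 E1]] [g2 [h2 E2]]; exists (fun e E => g1 e E + g2 e E); split.
  by move=> e D De; rewrite big_split /= h1 // h2 // addr0.
move=> a da; rewrite E1 // E2 // -big_split /=; apply: eq_bigr => e _.
by rewrite /subsum big_split.
Qed.

(** Project [h] away from the indicators of the [e]-spaces above [D], for all [D] of dimension below
    [e]. The remainder [g0] is harmonic, and the part removed lifts to a sum of [subsum d] with
    [d < e], where induction applies. *)
Lemma harmonic_sum_subsum e h : (e <= k)%N -> harmonic_sum (subsum e h).
Proof.
have [r] := ubnP e; elim: r => // r IHr in e h * => /ltnSE le_er le_ek.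
pose A (D E : X) : rat := ((\dim D < e) && (\dim E == e) && (D <= E)%VS)%N%:R.
have [u uP] := fun_orthogonal_decomposition A h.
pose g0 E := h E - \sum_D u D * A D E.
have harm_g0 : harmonic e g0.
  move=> D De; rewrite -[RHS](uP D) [LHS]big_mkcond; apply: eq_bigr => E _.
  by rewrite /A De /= -/(g0 E); case: ifP; rewrite ?mul1r ?mul0r.
(* The binomial is the number of [e]-spaces between [D] and a [k]-space containing it. *)
pose h' d (D : X) := u D * qbin q (k - d) (e - d).
have hs m : (m <= e)%N ->
    harmonic_sum (fun a => \sum_(d < m) subsum d (h' d) a).
  elim: m => [_|m IHm lt_me].
    exists (fun _ _ => 0); split=> [e' D _|a _]; first exact: big1.
    by rewrite big_ord0 big1 // => e' _; exact: big1.
  have [g [harm_g Eg]] : harmonic_sum (fun a =>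
      \sum_(d < m) subsum d (h' d) a + subsum m (h' m) a).
    by apply: harmonic_sumD; [apply: IHm; lia | apply: IHr; lia].
  by exists g; split=> // a da; rewrite big_ord_recr /= Eg.
have [g1 [harm_g1 Eg1]] := hs e (leqnn e).
have [g [harm_g Eg]] : harmonic_sum (fun a =>
    subsum e g0 a + \sum_(d < e) subsum d (h' d) a).
  apply: harmonic_sumD; last exact: hs.
  exists (fun e' => if e' == e then g0 else fun=> 0); split=> [e'|a _].
    by case: eqP => [->//|_ D _]; exact: big1.
  rewrite (bigD1 (inord e)) //= inordK // eqxx big1 ?addr0 // => e' ne'.
  case: eqP => [ee|_]; last exact: big1.
  by case/eqP: ne'; apply: val_inj; rewrite /= inordK.
exists g; split=> // a da; rewrite -Eg //.
rewrite /subsum.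
have -> : \sum_(d < e) \sum_(D : X | (\dim D == d) && (D <= a)%VS) h' d D =
    \sum_(E : X | (\dim E == e) && (E <= a)%VS) \sum_D u D * A D E.
  transitivity (\sum_(D : X | (\dim D < e)%N && (D <= a)%VS) h' (\dim D) D).
    rewrite (exchange_big_dep (fun D : X => (D <= a)%VS)) /=; last first.
      by move=> d D _ /andP[].
    rewrite [RHS]big_mkcondl; apply: eq_bigr => D Da.
    rewrite -(big_ord1_eq +%R (fun d => h' d D)); apply: eq_bigl => d.
    by rewrite Da andbT eq_sym.
  rewrite exchange_big /= [RHS](bigID (fun D : X => (\dim D < e)%N && (D <= a)%VS)) /=.
  rewrite [X in _ + X]big1 ?addr0.
    apply: eq_bigr => D /andP[De Da]; rewrite -mulr_sumr; congr (_ * _).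
    rewrite sum_indicator -da.
    have := card_interval (e - \dim D) Da; rewrite subnKC ?(ltnW De) // => <-.
    congr (_%:R); apply: eq_card => E; rewrite !inE De /=.
    by case: (_ == e); case: (_ <= a)%VS; rewrite ?andbT ?andbF.
  move=> D DN; apply: big1 => E /andP[_ Ea]; rewrite /A.
  case: (boolP (_ && _)) => [/andP[/andP[De _] DE]|]; last by rewrite mulr0.
  by move: DN; rewrite De (subv_trans DE Ea).
by rewrite -big_split /=; apply: eq_bigr => E _; rewrite /g0 subrK.
Qed.

Lemma harmonic_decomposition f : harmonic_sum f.
Proof.
have [g [harm_g Eg]] := harmonic_sum_subsum f (leqnn k).
exists g; split=> // a da; rewrite -Eg // /subsum.
rewrite (bigD1 a) ?subvv ?da ?eqxx //= big1 ?addr0 // => E /andP[/andP[/eqP dE Ea]].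
by case/eqP; apply/eqP; rewrite eqEdim Ea dE da leqnn.
Qed.

End HarmonicDecomposition.

(** * The Frankl-Wilson matrix and its quadratic form *)

Section ErdosKoRado.
Variables (F : finFieldType) (n T m : nat).
Local Notation X := {vspace 'rV[F]_n}.
Local Notation q := (#|F|%:R : rat).
Let t := T.+1.
Let k := (T.+1 + m)%N.
Hypothesis le_2kn : (2 * k <= n)%N.

Let q_gt1 : 1 < q := field_card_gt1 F.

Definition disjoint_count j (a b : X) : rat :=
  #|[set J : X | [&& \dim J == j, (J <= a)%VS & (J :&: b == 0)%VS]]|%:R.

(** The denominator is the number of [k]-spaces through a [t]-space [U] that avoid a [(k-i)]-space
    disjoint from [U]; it cancels against [sum_disjoint_count]. *)
Definition fw_coef i : rat :=
  fw_weight q T m i / (q ^+ ((k - i) * m) * qbin q (n - T.+1 - (k - i)) m).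

Definition fw_mx (a b : X) : rat :=
  (a == b)%:R + \sum_(i < T.+1) fw_coef i * disjoint_count (k - i)%N a b.

(** Inside [a], a subspace of codimension [i < t] cannot avoid [a :&: b], so every [disjoint_count]
    is zero. *)
Lemma fw_mx_meet a b : \dim a = k -> (t <= \dim (a :&: b))%N ->
  fw_mx a b = (a == b)%:R.
Proof.
move=> da tab; rewrite /fw_mx big1 ?addr0 // => i _; have lti := ltn_ord i.
rewrite /disjoint_count (_ : [set J : X | _] = set0) ?cards0 ?mulr0 //.
apply/setP => J; rewrite !inE; apply/negbTE/negP => /and3P[/eqP dJ Ja /eqP Jb].
have : (J :&: (a :&: b) = 0)%VS.
  by rewrite capvA capvC capvA [(b :&: J)%VS]capvC Jb cap0v.
move/dimv_disjoint_sum; have : (J + a :&: b <= a)%VS by rewrite subv_add Ja capvSl.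
by move/dimvS; rewrite da dJ => + E; rewrite E; rewrite /k /t in tab *; lia.
Qed.

Lemma sum_disjoint_count j (a U : X) : \dim a = k -> \dim U = t ->
  \sum_(b : X | (\dim b == k) && (U <= b)%VS) disjoint_count j a b =
  (q ^+ (\dim (U :&: a) * j) * qbin q (k - \dim (U :&: a)) j) *
  (q ^+ (j * m) * qbin q (n - T.+1 - j) m).
Proof.
move=> da dU.
transitivity (\sum_(J : X | (\dim J == j) && (J <= a)%VS)
    \sum_(b : X | (\dim b == k) && (U <= b)%VS) (J :&: b == 0)%VS%:R : rat).
  rewrite exchange_big /=; apply: eq_bigr => b _; rewrite sum_indicator.
  congr (_%:R); apply: eq_card => J.
  by rewrite !inE; case: (_ == j); rewrite ?andbF ?andbT //= andbC.
pose N : rat := q ^+ (j * m) * qbin q (n - T.+1 - j) m.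
rewrite (eq_bigr (fun J : X => (U :&: J == 0)%VS%:R * N)) => [|J /andP[/eqP dJ Ja]].
  rewrite -mulr_suml sum_indicator -/N; congr (_ * _).
  have := @card_between F n 0%VS (U :&: a)%VS a j (sub0v _) (capvSr _ _) (cap0v _).
  rewrite dimv0 add0n subn0 da => <-; congr (_%:R); apply: eq_card => J.
  rewrite !inE sub0v /=; case: (boolP (J <= a)%VS) => Ja; rewrite ?andbF //=.
  by rewrite [RHS]andbC andbT capvA [(J :&: U)%VS]capvC -capvA (capv_idPl Ja).
rewrite sum_indicator; case: eqP => [UJ|UJ]; rewrite ?mul1r ?mul0r.
  have := @card_between F n U J fullv m (subvf _) (subvf _) UJ.
  rewrite dU dJ dimvf /dim /= mul1n -/N => <-; congr (_%:R); apply: eq_card => b.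
  rewrite !inE subvf capvC /=.
  by case: (_ == k); rewrite ?andbF ?andbT //= ?andbT ?andbF // andbC.
rewrite (_ : [set b : X | _] = set0) ?cards0 //.
apply/setP => b; rewrite !inE; apply/negbTE/negP => /andP[/eqP Jb /andP[_ Ub]].
apply: UJ; apply/eqP; rewrite -subv0 -Jb subv_cap capvSr /=.
exact: subv_trans (capvSl _ _) Ub.
Qed.

(** If [a] contains [U], only the identity contributes, since all [qbin] factors vanish. Otherwise
    the identity contributes nothing, and the weights were chosen to give 1. *)
Lemma sum_fw_mx_above (a U : X) : \dim a = k -> \dim U = t ->
  \sum_(b : X | (\dim b == k) && (U <= b)%VS) fw_mx a b = 1.
Proof.
move=> da dU; rewrite big_split /= exchange_big /=.
have count i : (i <= T)%N ->
    \sum_(b : X | (\dim b == k) && (U <= b)%VS)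
      fw_coef i * disjoint_count (k - i)%N a b =
    fw_weight q T m i *
    (q ^+ (\dim (U :&: a) * (k - i)) * qbin q (k - \dim (U :&: a)) (k - i)).
  move=> leiT; rewrite -mulr_sumr.
  have -> : \sum_(b : X | (\dim b == k) && (U <= b)%VS) disjoint_count (k - i)%N a b =
      (q ^+ (\dim (U :&: a) * (k - i)) * qbin q (k - \dim (U :&: a)) (k - i)) *
      (q ^+ ((k - i) * m) * qbin q (n - T.+1 - (k - i)) m).
    exact: sum_disjoint_count.
  rewrite /fw_coef; set A := _ * qbin q (k - _) _; set B := _ * qbin q (n - _ - _) _.
  rewrite [A * B]mulrC mulrA divfK // lt0r_neq0 // mulr_gt0 ?exprn_gt0 //.
    exact: lt_trans q_gt1.
  by apply: qbin_gt0 => //; move: le_2kn; rewrite /k; lia.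
rewrite (eq_bigr (fun i : 'I_T.+1 => fw_weight q T m i *
    (q ^+ (\dim (U :&: a) * (k - i)) * qbin q (k - \dim (U :&: a)) (k - i))));
  last by move=> i _; exact: count (leq_ord i).
case: (boolP (U <= a)%VS) => Ua.
  rewrite (bigD1 a) /=; last by rewrite da eqxx Ua.
  rewrite eqxx big1 ?addr0 => [|b /andP[_]]; last by rewrite eq_sym => /negbTE->.
  rewrite big1 ?addr0 // => i _; have lti := ltn_ord i.
  rewrite qbin_small ?mulr0 // (capv_idPl Ua) dU /k /t; lia.
rewrite big1 ?add0r; last first.
  move=> b /andP[_ Ub]; case: eqP => // ab; by rewrite ab Ub in Ua.
apply: (@sum_fw_weight rat q (field_card_ge2 F) T m).
rewrite -ltnS -[T.+1]dU ltn_neqAle dimvS ?capvSl // andbT.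
by apply: contra Ua => /eqP d; apply/capv_idPl/eqP; rewrite eqEdim capvSl d leqnn.
Qed.

Lemma fw_mx_harmonic e g : harmonic e g -> (t < e <= k)%N ->
  exists2 c, 0 <= c & forall a : X, \dim a = k ->
    \sum_(b : X | \dim b == k) fw_mx a b * subsum e g b =
    c * subsum e g a.
Proof.
move=> harm_g /andP[lt_te le_ek].
eexists.
  apply: (@fw_eigenvalue_ge0 _ q (field_card_ge2 F) T m n (e - t) k e) => //.
  - by rewrite subn_gt0 lt_te /= leq_subLR.
  - by rewrite subnKC // ltnW.
move=> a da; rewrite (eq_bigr (fun b => (a == b)%:R * subsum e g b +
  \sum_(i < T.+1) fw_coef i * (disjoint_count (k - i)%N a b * subsum e g b))); last first.
  by move=> b _; rewrite mulrDl mulr_suml; congr (_ + _);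
    apply: eq_bigr => i _; rewrite mulrA.
rewrite big_split /= mulrDl mul1r; congr (_ + _).
  rewrite (bigD1 a) ?da //= eqxx mul1r big1 ?addr0 // => b /andP[_].
  by rewrite eq_sym => /negbTE->; rewrite mul0r.
rewrite exchange_big mulr_suml; apply: eq_bigr => i _.
by rewrite -mulr_sumr (disjoint_count_eigen _ harm_g) // mulrA.
Qed.

(** The right side does not depend on [a]: the matrix sends every function lifted from [t]-spaces to
    a constant. *)
Lemma fw_mx_subsum_low h (a : X) : \dim a = k ->
  \sum_(b : X | \dim b == k) fw_mx a b * subsum t h b =
  \sum_(U : X | \dim U == t) h U.
Proof.
move=> da.
transitivity (\sum_(U : X | \dim U == t)
    h U * \sum_(b : X | (\dim b == k) && (U <= b)%VS) fw_mx a b); last first.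
  by apply: eq_bigr => U /eqP dU; rewrite sum_fw_mx_above ?mulr1.
under eq_bigr => b _ do rewrite mulr_sumr.
rewrite (exchange_big_dep (fun U : X => \dim U == t)) /=; last first.
  by move=> b U _ /andP[].
apply: eq_bigr => U dU; rewrite mulr_sumr; apply: eq_big => b.
  by rewrite dU.
by move=> _; rewrite mulrC.
Qed.

(** Each [e]-space of [a] lies in [qbin q (k - e) (t - e)] of its [t]-spaces. Thus degrees below [t]
    also fall under [fw_mx_subsum_low]. *)
Lemma subsum_raise e g (a : X) : (e <= t)%N -> \dim a = k ->
  subsum e g a =
  subsum t (fun U => (qbin q (k - e) (t - e))^-1 * subsum e g U) a.
Proof.
move=> le_et da; rewrite /subsum -mulr_sumr.
apply: (canRL (mulKf _)).
  apply: lt0r_neq0; apply: qbin_gt0 => //; rewrite /k /t; lia.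
rewrite (exchange_big_dep (fun E : X => (\dim E == e) && (E <= a)%VS)) /=; last first.
  by move=> U E /andP[_ Ua] /andP[-> EU]; exact: subv_trans Ua.
rewrite mulr_sumr; apply: eq_bigr => E /andP[/eqP dE Ea].
rewrite sumr_const -[RHS]mulr_natl; congr (_ * _).
have := card_interval (t - e) Ea; rewrite dE da subnKC // => <-; congr (_%:R).
apply: eq_card => U; rewrite !inE unfold_in /= eqxx.
by case: (_ == t); case: (_ <= a)%VS; case: (E <= _)%VS.
Qed.

Lemma card_subspaces d :
  #|[set a : X | \dim a == d]|%:R = qbin q n d.
Proof.
have := card_above (0%VS : X) d; rewrite dimv0 leq0n !subn0 => <-.
by congr (_%:R); apply: eq_card => a; rewrite !inE sub0v.
Qed.

(* On harmonic functions [fw_mx] is zero in degrees 1 to [t], by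
   [sum_fw_mx_above], and nonnegative in higher degrees, so its quadratic form is
   at least that of its component of degree 0. *)
Theorem erdos_ko_rado_vspace (I : {set X}) :
    {in I, forall a, \dim a = k} ->
    {in I &, forall a b, t <= \dim (a :&: b)}%N ->
  #|I|%:R <= qbin q (n - t) (k - t).
Proof.
move=> dI tI.
pose f (a : X) : rat := (a \in I)%:R.
have [g [harm_g Eg]] := harmonic_decomposition k f.
pose V := qbin q n k.
have V0 : 0 < V by apply: qbin_gt0 => //; lia.
have sumf : \sum_(a : X | \dim a == k) f a = #|I|%:R.
  rewrite sum_indicator; congr (_%:R); apply: eq_card => a; rewrite !inE.
  by case: (boolP (a \in I)) => //= aI; rewrite dI ?eqxx.
have g0E (a : X) : subsum 0 (g 0%N) a = g 0%N 0%VS.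
  rewrite /subsum (big_pred1 0%VS) // => E; rewrite dimv_eq0.
  by rewrite /=; case: eqP => //= ->; rewrite sub0v.
have sum_e l e : (0 < e)%N -> \sum_(a : X | \dim a == l) subsum e (g e) a = 0.
  move=> e0; rewrite -[RHS](subsum_orthogonal l (fun=> 1) (harm_g e) e0).
  apply: eq_bigr => a _.
  rewrite [X in _ * X](_ : _ = 1) ?mulr1 //.
  rewrite /subsum (big_pred1 0%VS) // => E; rewrite dimv_eq0.
  by rewrite /=; case: eqP => //= ->; rewrite sub0v.
(* The degree 0 component is the mean of [f], because the other degrees sum to zero. *)
have g0V : g 0%N 0%VS * V = #|I|%:R.
  rewrite -sumf (eq_bigr (fun a => \sum_(e < k.+1) subsum e (g e) a)); last first.
    by move=> a /eqP; exact: Eg.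
  rewrite exchange_big big_ord_recl /= [X in _ + X]big1 ?addr0 => [|e _];
    last exact: (sum_e k (bump 0 e)).
  rewrite (eq_bigr _ (fun a _ => g0E a)) sumr_const -[RHS]mulr_natr.
  by rewrite /V -card_subspaces cardsE.
pose Q := \sum_(a : X | \dim a == k) f a * \sum_(b : X | \dim b == k) fw_mx a b * f b.
(* On pairs from [I] the matrix is the identity. *)
have QI : Q = #|I|%:R.
  rewrite -sumf; apply: eq_bigr => a /eqP da; rewrite /f.
  case: (boolP (a \in I)) => aI; last by rewrite mul0r.
  rewrite mul1r (bigD1 a) ?da //= aI fw_mx_meet ?tI // eqxx mulr1 big1 ?addr0 //.
  move=> b /andP[_ ba]; case: (boolP (b \in I)) => bI; last by rewrite mulr0.
  by rewrite fw_mx_meet ?tI // eq_sym (negbTE ba) mul0r.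
have Qe e : (e <= k)%N ->
    (if e == 0%N then #|I|%:R ^+ 2 / qbin q (n - t) (k - t) else 0) <=
    \sum_(a : X | \dim a == k) f a *
      \sum_(b : X | \dim b == k) fw_mx a b * subsum e (g e) b.
  move=> le_ek; have [le_et|lt_te] := leqP e t.
    pose hU U := (qbin q (k - e) (t - e))^-1 * subsum e (g e) U.
    rewrite (eq_bigr (fun a => f a * \sum_(U : X | \dim U == t) hU U)); last first.
      move=> a /eqP da; congr (_ * _); rewrite -(fw_mx_subsum_low hU da).
      by apply: eq_bigr => b /eqP db; rewrite [in LHS]subsum_raise.
    rewrite -mulr_suml sumf; case: eqP => [e0|/eqP]; last first.
      by rewrite -lt0n => e0; rewrite -mulr_sumr sum_e // !mulr0.
    rewrite /hU e0 !subn0 -mulr_sumr.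
    have -> : \sum_(U : X | \dim U == t) subsum 0 (g 0%N) U = qbin q n t * g 0%N 0%VS.
      rewrite (eq_bigr _ (fun U _ => g0E U)) sumr_const -[LHS]mulr_natl.
      by rewrite -card_subspaces cardsE.
    (* Counting the flags of a [t]-space in a [k]-space in both orders turns the constant into
       [#|I|] divided by the number of [k]-spaces through a [t]-space. *)
    have := qbin_trinomial q_gt1 t m (n - k).
    have -> : (t + m + (n - k) = n)%N by move: le_2kn; rewrite /k; lia.
    have -> : (m + (n - k) = n - t)%N by move: le_2kn; rewrite /k; lia.
    rewrite -/k -/V (_ : (k - t = m)%N); last by rewrite addKn.
    have kt0 : qbin q k t != 0 by rewrite lt0r_neq0 // qbin_gt0 ?leq_addr.
    have nm0 : qbin q (n - t) m != 0.
      by rewrite lt0r_neq0 // qbin_gt0 //; move: le_2kn; rewrite /k; lia.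
    move: g0V (qbin q n t) (qbin q k t) (qbin q (n - t) m) kt0 nm0 => <-.
    move: (g _ _) V V0 => c V V0 A B C B0 C0 AC.
    have -> : (c * V) ^+ 2 / C = c * V * (c * (V * B) / (B * C)) by field; apply/andP.
    by rewrite -AC le_eqVlt; apply/orP; left; apply/eqP; field; apply/andP.
  rewrite gtn_eqF; last by apply: leq_trans lt_te.
  have [|c c0 Ec] := fw_mx_harmonic (harm_g e); first by rewrite lt_te.
  rewrite (eq_bigr (fun a => c * (f a * subsum e (g e) a))); last first.
    by move=> a /eqP da; rewrite Ec // mulrCA.
  rewrite -mulr_sumr mulr_ge0 //.
  (* Expanding [f] leaves only squares, as components of different degrees are orthogonal. *)
  rewrite (eq_bigr (fun a => \sum_(e' < k.+1) subsum e' (g e') a * subsum e (g e) a)).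
    rewrite exchange_big /=; apply: sumr_ge0 => e' _.
    have [->|ne] := eqVneq (e' : nat) e.
      by apply: sumr_ge0 => a _; rewrite -expr2 sqr_ge0.
    case: (ltngtP e' e) ne => // [lt|gt] _; last by rewrite subsum_orthogonal.
    rewrite (eq_bigr _ (fun a _ => mulrC _ _)) subsum_orthogonal //.
  by move=> a /eqP da; rewrite Eg // mulr_suml.
have : #|I|%:R ^+ 2 / qbin q (n - t) (k - t) <= Q.
  rewrite /Q (eq_bigr (fun a => \sum_(e < k.+1) f a *
      \sum_(b : X | \dim b == k) fw_mx a b * subsum e (g e) b)); last first.
    move=> a _; rewrite -mulr_sumr; congr (_ * _); rewrite exchange_big /=.
    by apply: eq_bigr => b /eqP db; rewrite Eg // mulr_sumr.
  rewrite exchange_big /=; apply: (@le_trans _ _ (\sum_(e < k.+1)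
    if e == 0%N :> nat then #|I|%:R ^+ 2 / qbin q (n - t) (k - t) else 0)).
    by rewrite big_ord_recl /= big1 ?addr0.
  by apply: ler_sum => e _; apply: Qe; apply: leq_ord.
rewrite QI; have [->|I0] := eqVneq (#|I|%:R : rat) 0.
  by move=> _; exact: qbin_ge0.
have pI : 0 < #|I|%:R :> rat by rewrite lt0r I0 /=.
rewrite ler_pdivrMr; last by apply: qbin_gt0 => //; rewrite /k /t; lia.
by rewrite expr2 ler_pM2l.
Qed.

End ErdosKoRado.

(** * Common non-neighbours of two adjacent vertices *)

Lemma ler_sum_term (R : numDomainType) (I : finType) (P : pred I) (f : I -> R) i :
  P i -> (forall j, P j -> 0 <= f j) -> f i <= \sum_(j | P j) f j.
Proof.
move=> Pi f0; rewrite (bigD1 i) //= lerDl; apply: sumr_ge0 => j /andP[Pj _].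
exact: f0.
Qed.

Lemma dim_sum_two s z T : (s + z = T.+1 + T.+1)%N -> (z <= T)%N ->
  s = (T + (T - z).+2)%N.
Proof. by lia. Qed.

Section TwoMeets.
Variables (F : finFieldType) (n : nat).
Local Notation X := {vspace 'rV[F]_n}.
Local Notation q := (#|F|%:R : rat).
Let q_gt1 : 1 < q := field_card_gt1 F.

Lemma exists_between (Z A : X) d : (Z <= A)%VS -> (\dim Z <= d <= \dim A)%N ->
  exists B : X, [/\ (Z <= B)%VS, (B <= A)%VS & \dim B = d].
Proof.
move=> ZA /andP[Zd dA].
have := card_interval (d - \dim Z) ZA; rewrite subnKC // => E.
have : 0 < #|[set B : X | [&& (Z <= B)%VS, (B <= A)%VS & \dim B == d]]|%:R :> rat.
  by rewrite E qbin_gt0 // leq_sub2r.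
rewrite ltr0n => /card_gt0P[B]; rewrite inE => /and3P[ZB BA /eqP dB].
by exists B.
Qed.

(* A space [a] counted here contains the sum, of dimension [T + 2 + j], of a
   [T + 1]-subspace of [b] and one of [b'], which meet in a subspace of [b :&: b']
   of dimension [T - j]. *)
Lemma card_two_meets k T (b b' : X) : (T < k)%N -> (k <= n)%N ->
  \dim b = k -> \dim b' = k -> (\dim (b :&: b') <= T)%N ->
  #|[set a : X | [&& \dim a == k, (T < \dim (a :&: b))%N &
                    (T < \dim (a :&: b'))%N]]|%:R <=
  \sum_(j < T.+1) qbin q T (T - j) * qbin q (k - T + j) j.+1 ^+ 2 *
    (if (T + j.+2 <= k)%N then qbin q (n - (T + j.+2)) (k - (T + j.+2)) else 0).
Proof.
move=> Tk kn db db' dbb.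
(* Enlarging [b :&: b'] to dimension exactly [T] bounds the choices of [Z] independently of
   [\dim (b :&: b')]. *)
have [W [bbW _ dW]] :
    exists W : X, [/\ (b :&: b' <= W)%VS, (W <= fullv)%VS & \dim W = T].
  by apply: exists_between; rewrite ?subvf // dbb dimvf /dim /= mul1n; lia.
pose PZ (j : nat) (Z : X) := [&& (Z <= W)%VS, (Z <= b :&: b')%VS & \dim Z == (T - j)%N].
pose PU (Z c U : X) := [&& (Z <= U)%VS, (U <= c)%VS & \dim U == T.+1].
pose S := [set a : X | [&& \dim a == k, (T < \dim (a :&: b))%N &
                    (T < \dim (a :&: b'))%N]].
pose f3 (a U U' : X) : rat := (U + U' <= a)%VS%:R.
pose PU' (j : nat) (Z U U' : X) := PU Z b' U' && (\dim (U + U') == T + j.+2)%N.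
pose f2 (a : X) (j : nat) (Z U : X) : rat := \sum_(U' | PU' j Z U U') f3 a U U'.
pose f1 (a : X) (j : nat) (Z : X) : rat := \sum_(U | PU Z b U) f2 a j Z U.
pose ind (a : X) (j : nat) : rat := \sum_(Z | PZ j Z) f1 a j Z.
have f2_ge0 a j Z U : 0 <= f2 a j Z U by apply: sumr_ge0 => U' _; exact: ler0n.
have f1_ge0 a j Z : 0 <= f1 a j Z by apply: sumr_ge0 => U _.
have ind0 a j : 0 <= ind a j by apply: sumr_ge0 => Z _.
have ind1 a : a \in S -> 1 <= \sum_(j < T.+1) ind a j.
  rewrite inE => /and3P[/eqP da ab ab'].
  (* With [Z] the full triple intersection, any [U] and [U'] chosen above it satisfy [U :&: U' = Z],
     so [U + U'] has the predicted dimension. *)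
  pose Z := (a :&: b :&: b')%VS.
  have dZ : (\dim Z <= T)%N.
    by apply: leq_trans dbb; apply: dimvS; rewrite capvS ?capvSr.
  have [U [ZU Uab dU]] :
      exists U : X, [/\ (Z <= U)%VS, (U <= a :&: b)%VS & \dim U = T.+1].
    by apply: exists_between; rewrite ?capvSl // ab andbT leqW.
  have [U' [ZU' Uab' dU']] :
      exists U : X, [/\ (Z <= U)%VS, (U <= a :&: b')%VS & \dim U = T.+1].
    apply: exists_between; rewrite ?ab' ?andbT ?leqW //.
    by rewrite /Z -capvA [(b :&: b')%VS]capvC capvA capvSl.
  have UU' : (U :&: U')%VS = Z.
    apply/eqP; rewrite eqEsubv; apply/andP; split; last by rewrite subv_cap ZU ZU'.
    rewrite /Z subv_cap (subv_trans (capvSl _ _) Uab) /=.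
    exact: subv_trans (capvSr _ _) (subv_trans Uab' (capvSr _ _)).
  have [Ua Ub] : (U <= a)%VS /\ (U <= b)%VS.
    by split; apply: subv_trans Uab _; rewrite ?capvSl ?capvSr.
  have [Ua' Ub'] : (U' <= a)%VS /\ (U' <= b')%VS.
    by split; apply: subv_trans Uab' _; rewrite ?capvSl ?capvSr.
  have Zbb : (Z <= b :&: b')%VS by rewrite /Z capvS ?capvSr.
  have ltj : (T - \dim Z < T.+1)%N by rewrite ltnS leq_subr.
  have PUZ : PU Z b U by rewrite /PU ZU Ub dU eqxx.
  have PUZ' : PU' (T - \dim Z)%N Z U U'.
    rewrite /PU' /PU ZU' Ub' dU' eqxx /=.
    by have := dimv_sum_cap U U'; rewrite UU' dU dU' => /dim_sum_two->.
  have PZZ : PZ (T - \dim Z)%N Z by rewrite /PZ (subv_trans Zbb bbW) Zbb subKn /=.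
  have t0 : ind a (T - \dim Z)%N <= \sum_(j < T.+1) ind a j :=
    @ler_sum_term rat _ xpredT (fun j : 'I_T.+1 => ind a j) (Ordinal ltj)
    isT (fun j _ => ind0 a j).
  have t1 : f1 a (T - \dim Z)%N Z <= ind a (T - \dim Z)%N :=
    @ler_sum_term rat _ _ (f1 a _) Z PZZ (fun Z _ => f1_ge0 a _ Z).
  have t2 : f2 a (T - \dim Z)%N Z U <= f1 a (T - \dim Z)%N Z :=
    @ler_sum_term rat _ _ (f2 a _ _) U PUZ (fun U _ => f2_ge0 a _ _ U).
  have t3 : f3 a U U' <= f2 a (T - \dim Z)%N Z U :=
    @ler_sum_term rat _ _ (f3 a _) U' PUZ' (fun U' _ => ler0n _ _).
  have t4 : 1 <= f3 a U U' by rewrite /f3 subv_add Ua Ua'.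
  exact: le_trans t4 (le_trans t3 (le_trans t2 (le_trans t1 t0))).
apply: (@le_trans _ _ (\sum_(a : X | \dim a == k) \sum_(j < T.+1) ind a j)).
  rewrite -/S -sum1_card natr_sum.
  apply: (@le_trans _ _ (\sum_(a in S) \sum_(j < T.+1) ind a j)); first exact: ler_sum.
  rewrite [leRHS](bigID (fun a => a \in S)) /=.
  rewrite [X in _ <= X + _](eq_bigl (fun a => a \in S)) => [|a]; last first.
    by rewrite inE; case: (_ == k).
  by rewrite lerDl; apply: sumr_ge0 => a _; apply: sumr_ge0 => j _.
rewrite exchange_big; apply: ler_sum => j _; rewrite /ind /f1 /f2 /f3 /PU'.
pose N : rat := if (T + j.+2 <= k)%N
  then qbin q (n - (T + j.+2)) (k - (T + j.+2)) else 0.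
have N0 : 0 <= N by rewrite /N; case: ifP => // _; exact: qbin_ge0.
have count c Z : \dim c = k -> (Z <= c)%VS -> \dim Z = (T - j)%N ->
    (#|PU Z c|%:R : rat) = qbin q (k - T + j) j.+1.
  move=> dc Zc dZ; have ltj := leq_ord j.
  have := card_interval j.+1 Zc; rewrite dZ dc.
  have -> : (T - j + j.+1 = T.+1)%N by lia.
  have -> : (k - (T - j) = k - T + j)%N by lia.
  move=> <-; congr (_%:R); apply: eq_card => U.
  by rewrite !inE.
apply: (@le_trans _ _ (\sum_(Z | PZ j Z) qbin q (k - T + j) j.+1 ^+ 2 * N)).
  rewrite exchange_big; apply: ler_sum => Z /and3P[_ ZBB /eqP dZ].
  rewrite exchange_big expr2 -mulrA -{1}(count b Z) // ?(subv_trans ZBB) ?capvSl //.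
  rewrite mulr_natl -sumr_const; apply: ler_sum => U _.
  rewrite exchange_big -(count b' Z) // ?(subv_trans ZBB) ?capvSr //.
  rewrite mulr_natl -sumr_const big_mkcondr; apply: ler_sum => U' _.
  case: ifP => // /eqP dUU; rewrite sum_indicator card_above dUU.
  exact: lexx.
rewrite sumr_const -[leLHS]mulr_natl mulrA; apply: ler_wpM2r => //.
apply: ler_wpM2r; first by rewrite sqr_ge0.
have := card_interval (T - j) (sub0v W); rewrite dimv0 add0n subn0 dW => <-.
rewrite ler_nat; apply: subset_leq_card; apply/subsetP => Z.
by rewrite !inE sub0v unfold_in => /and3P[-> _ ->].
Qed.

End TwoMeets.

Lemma leq_exists_add m l : (m <= l)%N -> exists u, l = (m + u)%N.
Proof. by move=> ml; exists (l - m)%N; rewrite subnKC. Qed.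

(* The distance from [i] to the nearer of [p - 1] and [p]: an integral quadratic is
   minimal at one or at two consecutive integers. *)
Definition dist_from (p i : nat) : nat :=
  if (p <= i)%N then (i - p)%N else (p.-1 - i)%N.

(** For [N >= 0] the minimum is at [i = 1], with value [1 + N + t]. For [N < 0] the quadratic minus
    [eps] has negative discriminant, hence is at least 1 at integers; [p] is placed next to the
    vertex [- N / 2], from which the values grow at least linearly. *)
Lemma quadratic_ge (eps t : nat) (N : int) :
    (0 <= N /\ eps%:Z <= N + t%:Z) \/ (N < 0 /\ N ^+ 2 < 4 * (t%:Z - eps%:Z)) ->
  exists p : nat, forall i : nat, (0 < i)%N ->
    (eps + 1 + dist_from p i)%N%:Z <= i%:Z ^+ 2 + i%:Z * N + t%:Z.
Proof.
case=> [[N0 hN]|[N0 hN]].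
  exists 1%N => i i0; rewrite /dist_from i0 !expr2.
  have : 0 <= (i%:Z - 1) * (i%:Z + N) by apply: mulr_ge0; lia.
  nia.
have [M EM] : exists M : nat, N = - M%:Z by exists `|N|%N; lia.
rewrite {}EM !expr2 in N0 hN *.
have oddM := odd_double_half M; rewrite -addnn in oddM.
move: (M./2) oddM => h; case: (odd M) => EM.
  exists h.+1 => i i0; rewrite /dist_from; case: (ltnP h i) => hi.
    by have [u Eu] := leq_exists_add hi; move: hN; rewrite -EM Eu addKn; nia.
  have [u Eu] := leq_exists_add hi.
  by move: hN; rewrite -EM Eu /= addKn; nia.
exists h => i i0; rewrite /dist_from; case: leqP => /leq_exists_add[u Eu].
  by move: hN; rewrite -EM Eu addKn; nia.
move: hN; rewrite -EM Eu addSn /= addKn; nia.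
Qed.

(** Each distance occurs at most twice, so two geometric series bound the sum; [Phi] is its
    telescoping primitive. *)
Lemma sum_dist_from (K : realFieldType) (y : K) p N : 0 <= y -> y <= 1 ->
  (1 - y) * \sum_(j < N) y ^+ dist_from p j.+1 <= 2.
Proof.
move=> y0 y1.
pose Phi j : K := if (p <= j.+1)%N then 2 - y ^+ (j.+1 - p) else y ^+ (p.-1 - j).
suff -> : (1 - y) * \sum_(j < N) y ^+ dist_from p j.+1 = Phi N - Phi 0%N.
  have pow l : 0 <= y ^+ l <= 1 by rewrite exprn_ge0 ?exprn_ile1.
  rewrite /Phi; case: ifP => _; case: ifP => _.
  - by have := pow (N.+1 - p)%N; have := pow (1 - p)%N; lra.
  - by have := pow (N.+1 - p)%N; have := pow (p.-1 - 0)%N; lra.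
  - by have := pow (p.-1 - N)%N; have := pow (1 - p)%N; lra.
  - by have := pow (p.-1 - N)%N; have := pow (p.-1 - 0)%N; lra.
elim: N => [|N IHN]; first by rewrite big_ord0 mulr0 subrr.
rewrite big_ord_recr /= mulrDr IHN /Phi /dist_from.
have [pN|pN] := leqP p N.+1.
  rewrite (leqW pN).
  by have -> : (N.+2 - p = (N.+1 - p).+1)%N; [lia | rewrite exprS; ring].
have [pN2|pN2] := leqP p N.+2.
  have -> : p = N.+2 by lia.
  by rewrite /= subnn subnn subSnn expr0 expr1; ring.
have [u ->] : exists u, p = (N + u).+3 by exists (p - N.+3)%N; lia.
have -> : ((N + u).+3.-1 - N.+1 = u.+1)%N by rewrite /=; lia.
have -> : ((N + u).+3.-1 - N = u.+2)%N by rewrite /=; lia.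
by rewrite !exprS; ring.
Qed.

(** The particular values of [epsilon] enter only here. The witness [c] is the reciprocal of
    [1 - y - y^2 + y^5] for [q = 2], and of [1 - y - y^2] at the least [q] of each later range. In
    the last inequality, [c ^+ 3] pays for three binomials, [1 - q^-1] for the geometric series, and
    4 is the 2 of [sum_dist_from] times the 2 of the bound by half. *)
Lemma qbin_const (q : nat) : (2 <= q)%N -> exists c : rat,
  [/\ 0 <= c, forall m j, qbin q%:R m j <= c * q%:R ^+ (j * (m - j)) &
    4 * c ^+ 3 * q%:R^-1 ^+ (epsilon q).+1 <= 1 - q%:R^-1].
Proof.
move=> q2; have x2 : 2 <= q%:R :> rat by rewrite ler_nat.
have x1 : 1 < q%:R :> rat by rewrite ltr1n.
set y : rat := q%:R^-1.
have y0 : 0 < y by rewrite invr_gt0; lra.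
have yx : y * q%:R = 1 by rewrite mulVf //; lra.
have suf c : 0 <= c -> 1 <= c * (1 - y - y ^+ 2 + y ^+ 5) ->
    forall m j, qbin q%:R m j <= c * q%:R ^+ (j * (m - j)).
  move=> c0 c1 m j; have := qbin_ub x1 m j x2; rewrite -!exprVn -/y => h.
  have := ler_wpM2l c0 h; apply: le_trans.
  have := qbin_ge0 x1 m j; move: (qbin _ _ _) => b b0.
  have := ler_wpM2r b0 c1; rewrite mul1r => /le_trans; apply.
  by rewrite le_eqVlt; apply/orP; left; apply/eqP; ring.
have y5 : 0 <= y ^+ 5 by rewrite exprn_ge0 // ltW.
have [q2'|q2'] := eqVneq q 2%N.
  have Ey : y = 1 / 2 by rewrite /y q2' mul1r.
  by exists (32 / 9); split; [lra | apply: suf; rewrite ?Ey; lra |];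
    rewrite q2' Ey /=; lra.
have [q3|q3] := eqVneq q 3%N.
  have Ey : y = 1 / 3 by rewrite /y q3 mul1r.
  by exists (9 / 5); split; [lra | apply: suf; rewrite ?Ey; lra |];
    rewrite q3 Ey /=; lra.
have [q4|q4] := eqVneq q 4%N.
  have Ey : y = 1 / 4 by rewrite /y q4 mul1r.
  by exists (16 / 11); split; [lra | apply: suf; rewrite ?Ey; lra |];
    rewrite q4 Ey /=; lra.
have [q8|q9] := leqP q 8.
  have x5 : 5 <= q%:R :> rat by rewrite ler_nat; lia.
  have y5' : y <= 1 / 5 by nra.
  exists (25 / 19); split; [lra | apply: suf; nra |].
  by rewrite /epsilon (negbTE q2') (negbTE q3) (negbTE q4) q8; nra.
have x9 : 9 <= q%:R :> rat by rewrite ler_nat; lia.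
have y9 : y <= 1 / 9 by nra.
exists (81 / 71); split; [lra | apply: suf; nra |].
rewrite /epsilon (negbTE q2') (negbTE q3) (negbTE q4) leqNgt q9 /= expr1; nra.
Qed.

(** This is where the quadratic comes from: it is the gain [i * D] of [qbin_ratio] minus the
    exponents of the three other binomials in the term [j = i - 1], with [k = T + 1 + m] and
    [n = D + k]. *)
Lemma two_meets_exponent T j p D : (j <= T)%N ->
  let i := j.+1 in let m := (i + p)%N in
  ((T - j) * j + 2 * (i * m))%N%:Z +
  (i%:Z ^+ 2 + i%:Z * ((D + (T.+1 + m))%N%:Z - 3 * (T.+1 + m)%N%:Z + T.+1%:Z - 1) +
   T.+1%:Z)
  = (i * D)%N%:Z.
Proof.
move=> jT i m; rewrite /m /i; have [u ->] := leq_exists_add jT.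
rewrite addKn expr2; nia.
Qed.

(** Comparing each term with the right side through [qbin_ratio] leaves a factor [c ^+ 3] and a
    power of [q^-1] that decays away from [p]; [qbin_const] then bounds the whole series by one
    half. *)
Lemma sum_two_meets_le (q n k T : nat) :
    (2 <= q)%N -> (T.+1 < k)%N -> (2 * k <= n)%N ->
    let N : int := n%:Z - 3 * k%:Z + T.+1%:Z - 1 in
    (0 <= N /\ (epsilon q)%:Z <= N + T.+1%:Z) \/
    (N < 0 /\ N ^+ 2 < 4 * (T.+1%:Z - (epsilon q)%:Z)) ->
  2 * \sum_(j < T.+1) qbin q%:R T (T - j) * qbin q%:R (k - T + j) j.+1 ^+ 2 *
    (if (T + j.+2 <= k)%N
     then qbin q%:R (n - (T + j.+2)) (k - (T + j.+2)) else 0) <=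
  qbin (q%:R : rat) (n - T.+1) (k - T.+1).
Proof.
move=> q2 Tk kn N /quadratic_ge[p hp].
have x1 : 1 < q%:R :> rat by rewrite ltr1n.
have x0 : 0 < q%:R :> rat by exact: lt_trans x1.
have [c [c0 hc hcc]] := qbin_const q2.
set x : rat := q%:R in x1 x0 hc hcc *; set y := x^-1 in hcc.
set eps := epsilon q in hp hcc.
set alpha := qbin x (n - T.+1) (k - T.+1).
have y0 : 0 <= y by rewrite invr_ge0 ltW.
have y1 : y <= 1 by rewrite invf_le1 // ltW.
have a0 : 0 <= alpha by apply: qbin_ge0.
have term (j : 'I_T.+1) : qbin x T (T - j) * qbin x (k - T + j) j.+1 ^+ 2 *
    (if (T + j.+2 <= k)%N then qbin x (n - (T + j.+2)) (k - (T + j.+2)) else 0) <=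
    c ^+ 3 * alpha * y ^+ eps.+1 * y ^+ dist_from p j.+1.
  have jT := leq_ord j; move: (nat_of_ord j) jT => {}j jT.
  have R0 : 0 <= c ^+ 3 * alpha * y ^+ eps.+1 * y ^+ dist_from p j.+1.
    by rewrite !mulr_ge0 ?exprn_ge0.
  case: ifP => [Tjk|_]; last by rewrite mulr0.
  have [a Ea] := leq_exists_add Tjk; have [D ED] : exists D, n = (D + k)%N.
    by exists (n - k)%N; lia.
  set e0 := ((T - j) * j + 2 * (j.+1 * (j.+1 + a)))%N.
  set e1 := (eps + 1 + dist_from p j.+1)%N.
  have le_exp : (e0 + e1 <= j.+1 * D)%N.
    have := hp j.+1 isT; have := two_meets_exponent a D jT.
    rewrite /N ED.
    have -> : (T.+1 + (j.+1 + a) = k)%N by lia.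
    rewrite -/e0 -/e1; move: e0 e1 => e0' e1'; lia.
  have E1 : (k - T + j - j.+1 = j.+1 + a)%N by lia.
  have E2 : (a + D = n - (T + j.+2))%N by lia.
  have E3 : (a + j.+1 + D = n - T.+1)%N by lia.
  have E4 : (a + j.+1 = k - T.+1)%N by lia.
  have -> : (k - (T + j.+2) = a)%N by lia.
  have hA := hc T (T - j)%N; rewrite subKn // in hA.
  have hB := hc (k - T + j)%N j.+1; rewrite E1 in hB.
  have hR := qbin_ratio x1 a j.+1 D; rewrite E2 E3 E4 -/alpha in hR.
  have A0 := qbin_ge0 x1 T (T - j); have B0 := qbin_ge0 x1 (k - T + j) j.+1.
  have R1 := qbin_ge0 x1 (n - (T + j.+2)) a.
  move: (qbin x T _) (qbin x (k - T + j) _) (qbin x (n - (T + j.+2)) a)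
    hA hB hR A0 B0 R1 => A B R hA hB hR A0 B0 R1.
  have -> : c ^+ 3 * alpha * y ^+ eps.+1 * y ^+ dist_from p j.+1 =
      c ^+ 3 * alpha / x ^+ e1.
    by rewrite -exprVn -mulrA -exprD /e1 addn1.
  rewrite ler_pdivlMr ?exprn_gt0 //.
  have le_AB : A * B ^+ 2 <= c ^+ 3 * x ^+ e0.
    rewrite /e0 exprD; apply: le_trans (_ : c * x ^+ ((T - j) * j) *
      (c * x ^+ (j.+1 * (j.+1 + a))) ^+ 2 <= _).
      apply: ler_pM => //; first exact: exprn_ge0.
      by rewrite lerXn2r // nnegrE; apply: le_trans hB.
    rewrite [(2 * _)%N]mulnC [x ^+ (_ * 2)]exprM.
    move: (x ^+ (j.+1 * _)) (x ^+ _) => u v.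
    by rewrite le_eqVlt; apply/orP; left; apply/eqP; ring.
  apply: (@le_trans _ _ (c ^+ 3 * x ^+ e0 * R * x ^+ e1)).
    by rewrite ler_wpM2r ?exprn_ge0 ?(ltW x0) // ler_wpM2r.
  have -> : c ^+ 3 * x ^+ e0 * R * x ^+ e1 = c ^+ 3 * (x ^+ (e0 + e1) * R).
    by rewrite exprD; ring.
  rewrite ler_wpM2l ?exprn_ge0 //; apply: le_trans hR.
  by rewrite ler_wpM2r // ler_eXn2l.
apply: (@le_trans _ _ (2 * \sum_(j < T.+1)
    c ^+ 3 * alpha * y ^+ eps.+1 * y ^+ dist_from p j.+1)).
  by rewrite ler_wpM2l // ler_sum.
rewrite -mulr_sumr.
have := sum_dist_from p T.+1 y0 y1.
have : 0 <= \sum_(j < T.+1) y ^+ dist_from p j.+1.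
  by apply: sumr_ge0 => j _; exact: exprn_ge0.
have : 0 <= y ^+ eps.+1 by exact: exprn_ge0.
have : 0 <= c ^+ 3 by exact: exprn_ge0.
have y1' : y < 1 by rewrite invf_lt1.
move: (\sum_(j < _) _) (y ^+ _) (c ^+ 3) hcc => S Y C hcc C0 Y0 S0 S2.
have h := le_trans (ler_wpM2r S0 hcc) S2.
have -> : 2 * (C * alpha * Y * S) = alpha * (4 * C * Y * S / 2) by field.
by rewrite -[leRHS]mulr1 ler_wpM2l //; lra.
Qed.

(** * The treewidth of the q-Kneser graph *)

Lemma gauss_binomialE (q n k : nat) : (2 <= q)%N -> (k <= n)%N ->
  gauss_binomial q n k = qbin q%:R n k.
Proof.
move=> q2 kn; have x1 : 1 < q%:R :> rat by rewrite ltr1n.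
have [b ->] : exists b, n = (b + k)%N by exists (n - k)%N; rewrite subnK.
rewrite /gauss_binomial big_add1 big_mkord addnK prodf_div.
rewrite -qbin_sym // qbinE /qfact -/(qfact _ k) big_split_ord /=.
have -> : \prod_(i < k) (q%:R ^+ (b + i.+1) - 1) =
    \prod_(i < k) (q%:R ^+ (b + i).+1 - 1) :> rat.
  by apply: eq_bigr => i _; rewrite addnS.
have := qfact_neq0 x1 b; have := qfact_neq0 x1 k; rewrite -/(qfact q%:R b).
move: (qfact _ _) (qfact _ _) (\prod_(i < k) _) => u v w u0 v0.
by field; apply/andP.
Qed.

Section KneserGraph.
Variables (F : finFieldType) (n k t : nat).
Hypotheses (t0 : (0 < t)%N) (lt_tk : (t < k)%N) (le_2kn : (2 * k <= n)%N).
Local Notation X := {vspace 'rV[F]_n}.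
Local Notation V := (subspace_of_dim F n k).
Local Notation q := (#|F|%:R : rat).

Lemma card_subspace_of_dim : #|{: V}|%:R = qbin q n k.
Proof.
rewrite -card_subspaces card_sig; congr (_%:R); apply: eq_card => U.
by rewrite !inE.
Qed.

Lemma card_subspace_pred (P : pred X) :
  #|[set U : V | P (val U)]| = #|[set U : X | (\dim U == k) && P U]|.
Proof.
rewrite -(card_imset _ val_inj); apply: eq_card => U; rewrite [RHS]inE.
apply/imsetP/andP => [[W]|[dU PU]]; first by rewrite inE => PW ->; rewrite (valP W).
by exists (Sub U dU : V); rewrite ?inE SubK.
Qed.

(** Take a hyperplane [H] of [U] missing some [v] of [T0], and add a vector outside [U]: the result
    still misses [v], and meets [U] in dimension at least [k - 1 >= t]. *)
Lemma star_nonneighbor (T0 : X) (U : V) : \dim T0 = t -> (T0 <= val U)%VS ->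
  exists2 W : V, ~~ (T0 <= val W)%VS & (t <= \dim (val U :&: val W))%N.
Proof.
move=> dT TU; have dU : \dim (val U) = k := eqP (valP U).
have T0n : T0 != 0%VS by rewrite -dimv_eq0 dT -lt0n.
pose v := vpick T0.
have vT : v \in T0 := memv_pick T0.
have v0 : v != 0 by rewrite vpick0.
have vU : v \in val U := subvP TU _ vT.
pose H := (val U :\: <[v]>)%VS.
have HU : (H <= val U)%VS := diffvSl _ _.
have dH : \dim H = k.-1.
  have := dimv_cap_compl (val U) <[v]>.
  by rewrite (capv_idPr _) -?memvE // dim_vline v0 dU => <-.
have vH : v \notin H.
  apply: contra v0 => vH; rewrite -memv0 -(capv_diff (val U) <[v]>) memv_cap vH.
  exact: memv_line.
have [w wU] : exists w, w \notin val U.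
  apply/existsP; rewrite -negb_forall; apply/negP => /forallP h.
  have /dimvS : (fullv <= val U)%VS by apply/subvP => w _; exact: h.
  rewrite dimvf dU /dim /= mul1n leqNgt => /negP; apply.
  by apply: leq_trans le_2kn; rewrite mul2n -addnn -[X in (X < _)%N]add0n
    ltn_add2r (leq_ltn_trans (leq0n t)).
have wH : w \notin H by apply: contra wU; apply: subvP.
have dW : \dim (H + <[w]>)%VS == k.
  by rewrite dim_add_line // dH prednK // (leq_ltn_trans (leq0n t)).
exists (Sub (H + <[w]>)%VS dW : V); rewrite SubK.
  apply: contra vH => /subvP/(_ v vT)/memv_addP[h hH [_ /vlineP[a ->] Ev]].
  have : a *: w \in val U.
    have -> : a *: w = v - h by rewrite Ev [h + _]addrC addrK.
    by rewrite rpredB // (subvP HU).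
  rewrite rpredZeq (negbTE wU) orbF => /eqP a0.
  by rewrite Ev a0 scale0r addr0.
apply: leq_trans (_ : (\dim H <= _)%N).
  by rewrite dH -ltnS prednK // (leq_ltn_trans (leq0n t)).
by apply: dimvS; rewrite subv_cap HU addvSl.
Qed.

Lemma card_indep_le (A : {set V}) : {in A &, forall u v, ~~ qKneser t u v} ->
  #|A|%:R <= qbin q (n - t) (k - t).
Proof.
move=> indepA; rewrite -(card_imset _ (val_inj : injective (val : V -> X))).
have [T Et] : exists T, t = T.+1 by exists t.-1; rewrite prednK.
have [m Ek] : exists m, k = (T.+1 + m)%N.
  by exists (k - t)%N; rewrite -Et subnKC // ltnW.
have := @erdos_ko_rado_vspace F n T m; rewrite -Ek -Et; apply=> //.
  by move=> _ /imsetP[U _ ->]; exact: eqP (valP U).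
move=> _ _ /imsetP[U UA ->] /imsetP[W WA ->].
by have := indepA _ _ UA WA; rewrite /qKneser -leqNgt.
Qed.

(** Conditions (1) and (2) without the square root: (1), and (2) with [N >= 0], give the first
    alternative; (2) with [N < 0] gives the second by squaring. *)
Hypothesis hN : let N : int := n%:Z - 3 * k%:Z + t%:Z - 1 in
  (0 <= N /\ (epsilon #|F|)%:Z <= N + t%:Z) \/
  (N < 0 /\ N ^+ 2 < 4 * (t%:Z - (epsilon #|F|)%:Z)).

Lemma card_common_nonneighbors (U W : V) : qKneser t U W ->
  2 * #|[set A : V | ~~ qKneser t U A & ~~ qKneser t W A]|%:R <=
  qbin q (n - t) (k - t).
Proof.
move=> adj; have [T Et] : exists T, t = T.+1 by exists t.-1; rewrite prednK.
have q2 : (2 <= #|F|)%N by exact: finNzRing_gt1.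
have Tk : (T < k)%N by apply: leq_trans lt_tk; rewrite Et leqnSn.
have kn : (k <= n)%N by apply: leq_trans le_2kn; rewrite mul2n -addnn leq_addr.
have UW : (\dim (val U :&: val W) <= T)%N by rewrite -ltnS -Et.
have := hN; move: lt_tk; rewrite Et => Tk' hN'.
apply: le_trans (sum_two_meets_le q2 Tk' le_2kn hN'); rewrite ler_wpM2l //.
apply: le_trans (card_two_meets Tk kn (eqP (valP U)) (eqP (valP W)) UW).
rewrite ler_nat (card_subspace_pred (fun A : X =>
  ~~ (\dim (val U :&: A) < T.+1)%N && ~~ (\dim (val W :&: A) < T.+1)%N)).
apply/subset_leq_card/subsetP => A; rewrite !inE -!leqNgt.
by rewrite [(A :&: val U)%VS]capvC [(A :&: val W)%VS]capvC.
Qed.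

Theorem treewidth_qKneser :
  (treewidth (@qKneser F n k t))%:~R = qbin q n k - qbin q (n - t) (k - t) - 1.
Proof.
have [T0 [_ _ dT]] : exists B : X, [/\ (0 <= B)%VS, (B <= fullv)%VS & \dim B = t].
  by apply: exists_between; rewrite ?subvf // dimv0 dimvf /dim /= mul1n; lia.
pose I := [set U : V | (T0 <= val U)%VS].
have cI : #|I|%:R = qbin q (n - t) (k - t).
  rewrite card_subspace_pred -[t]dT.
  have := card_above T0 k; rewrite dT ltnW // => <-; congr (_%:R).
  by apply: eq_card => U; rewrite !inE andbC.
rewrite (@treewidth_of_star V (@qKneser F n k t) I (#|I| %/ 2)).
- by rewrite !rmorphB /= !rmorph1 -cI -card_subspace_of_dim.
- exact: qKneser_simple (ltnW _).
- move=> U W; rewrite !inE => TU TW; rewrite /qKneser -leqNgt -dT.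
  by apply: dimvS; rewrite subv_cap TU TW.
- move=> U; rewrite inE => TU; have [W TW UW] := star_nonneighbor dT TU.
  by exists W; rewrite ?inE // /qKneser -leqNgt.
- move=> A /card_indep_le; by rewrite -cI ler_nat.
- move=> U W /card_common_nonneighbors; rewrite -cI -natrM ler_nat => h.
  by rewrite leq_divRL // mulnC.
by rewrite mulnC leq_trunc_div.
Qed.

End KneserGraph.

Theorem theorem1p2 (R : rcfType) (F : finFieldType) (q : nat) (hq : #|F| = q)
    (n k t : nat) (ht : (1 <= t)%N) (hkt : (t < k)%N) (hn : (2 * k <= n)%N)
    (hcond :
      ((t <= epsilon q)%N /\
         n%:Z > 3 * k%:Z - 2 * t%:Z + (epsilon q)%:Z) \/
      ((epsilon q < t)%N /\
         n%:R > 3 * k%:R - t%:R + 1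
                - 2 * Num.sqrt (t%:R - (epsilon q)%:R) :> R)) :
  (treewidth (@qKneser F n k t))%:~R =
    gauss_binomial q n k - gauss_binomial q (n - t) (k - t) - 1.
Proof.
have q2 : (2 <= q)%N by rewrite -hq; exact: finNzRing_gt1.
rewrite !gauss_binomialE //; [|lia|lia].
rewrite treewidth_qKneser ?hq //.
set N := _ - 1; set s := (epsilon q) in hcond *.
case: hcond => [[hts hlt]|[hts hlt]]; first by left; rewrite /N; lia.
have [N0|N0] := leP 0 N; [left | right]; split=> //; first by lia.
have s0 : 0 <= t%:R - s%:R :> R by rewrite subr_ge0 ler_nat ltnW.
have : (- N)%:~R < 2 * Num.sqrt (t%:R - s%:R) :> R.
  by rewrite /N !rmorphE /=; lra.
have M0 : 0 <= (- N)%:~R :> R by rewrite ler0z oppr_ge0 ltW.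
move=> h; rewrite -(ltr_int R) -sqrrN rmorphXn /=.
apply: (lt_le_trans (y := (2 * Num.sqrt (t%:R - s%:R)) ^+ 2)).
  by rewrite ltrXn2r // nnegrE; apply: le_trans (ltW h).
by rewrite exprMn sqr_sqrtr // !rmorphM /= rmorphB /=; lra.
Qed.
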